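(* Let $H$ be an ordered graph on $h$ vertices. Suppose that $B$ is a bottlegraph assigned to $H$. Then for every $\eta>0$, there exists an $n_0\in\mathbb N$ so that every ordered graph $G$ on $n\ge n_0$ vertices with $$\delta(G)\ge\left(1-\frac{1}{\chi_{cr}(B)}+\eta\right)n$$ contains an $H$-tiling covering all but at most $\eta n$ vertices.
   Context: An ordered graph $H$ on $h$ vertices is a graph with vertex set $[h]=\{1,\dots,h\}$ (more generally, a finite graph with a linearly ordered vertex set). An ordered graph $G$ contains a copy of $H$ if there is an order-preserving injection $\phi:[h]\to V(G)$ with $\phi(i)\phi(j)\in E(G)$ whenever $ij\in E(H)$. An $H$-tiling in $G$ is a collection of vertex-disjoint copies of $H$ in $G$; it is perfect if it covers all vertices of $G$. $\delta(G)$ denotes the minimum degree. For sets $X,Y$ of integers (or subsets of a linearly ordered set), $X<Y$ means $x<y$ for all $x\in X,y\in Y$. The critical chromatic number of an unordered graph $F$ is $\chi_{cr}(F):=(\chi(F)-1)\frac{|F|}{|F|-\sigma(F)}$, where $|F|$ is the number of vertices and $\sigma(F)$ is the size of the smallest possible colour class in any proper $\chi(F)$-colouring of $F$. Let $B$ be a complete $k$-partite unordered graph with (non-empty) parts $U_1,\dots,U_k$, where $k\ge2$, and let $\sigma$ be a permutation of $[k]$. An interval labeling of $B$ with respect to $\sigma$ is a bijection $\phi:V(B)\to[|B|]$ such that $\phi(U_i)<\phi(U_j)$ if $\sigma(i)<\sigma(j)$. For $t\in\mathbb N$, the blow-up $B(t)$ is obtained from $B$ by replacing every vertex $x$ by an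 independent set $V_x$ of $t$ vertices, and joining $u\in V_x$ to $v\in V_y$ precisely when $xy\in E(B)$. The ordered blow-up $(B(t),\phi)$ is the ordered graph obtained from $B(t)$ by equipping $V(B(t))$ with a vertex ordering satisfying $V_x<V_y$ for all $x,y\in V(B)$ with $\phi(x)<\phi(y)$. $B$ is a bottlegraph assigned to $H$ if for every permutation $\sigma$ of $[k]$ and every interval labeling $\phi$ of $B$ with respect to $\sigma$, there exists a constant $t=t(B,H,\phi)\in\mathbb N$ such that the ordered blow-up $(B(t),\phi)$ contains a perfect $H$-tiling. *)

(* Defs.v *)
From mathcomp Require Import all_boot all_order all_algebra all_fingroup.
From mathcomp Require Import reals.
Set Implicit Arguments.
Unset Strict Implicit.
Unset Printing Implicit Defensive.
Import Order.TTheory GRing.Theory Num.Theory.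

Record sgraph (V : finType) := SGraph {
  adj : rel V;
  adj_sym : symmetric adj;
  adj_irrefl : irreflexive adj }.

(* An ordered graph on n vertices is an [sgraph 'I_n], ordered by the values
   of the ordinals. *)
Notation ograph n := (sgraph 'I_n).

(* The default value #|V| of the minimum is never attained by a degree, so it
   only matters for the graph with no vertex. *)
Definition min_degree (V : finType) (G : sgraph V) : nat :=
  \big[minn/#|V|]_(v : V) #|[set w | adj G v w]|.

Definition proper_coloring (V : finType) (G : sgraph V) (k : nat)
    (c : {ffun V -> 'I_k}) : bool :=
  [forall x, forall y, adj G x y ==> (c x != c y)].

Definition colorable (V : finType) (G : sgraph V) (k : nat) : bool :=
  [exists c : {ffun V -> 'I_k}, proper_coloring G c].

Lemma colorable_ex (V : finType) (G : sgraph V) : exists k, colorable G k.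
Proof.
exists #|V|; apply/existsP; exists [ffun x => enum_rank x].
apply/forallP => x; apply/forallP => y; apply/implyP => xy; rewrite !ffunE.
by apply/eqP => /enum_rank_inj eq_xy; rewrite eq_xy adj_irrefl in xy.
Qed.

Definition chi (V : finType) (G : sgraph V) : nat := ex_minn (colorable_ex G).

(* Every colour class has at most #|V| elements, so the default value #|V| of
   the minima is harmless. *)
Definition sigma (V : finType) (G : sgraph V) : nat :=
  \big[minn/#|V|]_(c : {ffun V -> 'I_(chi G)} | proper_coloring G c)
    \big[minn/#|V|]_(i < chi G) #|[set x | c x == i]|.

Definition chi_cr (R : realType) (V : finType) (G : sgraph V) : R :=
  (((chi G)%:R - 1) * (#|V|%:R / (#|V|%:R - (sigma G)%:R)))%R.

Definition is_copy (h n : nat) (H : ograph h) (G : ograph n)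
    (f : {ffun 'I_h -> 'I_n}) : Prop :=
  (forall i j : 'I_h, i < j -> f i < f j) /\
  (forall i j : 'I_h, adj H i j -> adj G (f i) (f j)).

Definition tiling (h n : nat) (H : ograph h) (G : ograph n)
    (T : {set {ffun 'I_h -> 'I_n}}) : Prop :=
  (forall f, f \in T -> is_copy H G f) /\
  (forall f g, f \in T -> g \in T -> f != g ->
     [disjoint f @: setT & g @: setT]).

Definition covered (h n : nat) (T : {set {ffun 'I_h -> 'I_n}}) : {set 'I_n} :=
  \bigcup_(f in T) f @: setT.

Definition has_perfect_tiling (h n : nat) (H : ograph h) (G : ograph n) : Prop :=
  exists2 T, tiling H G T & covered T = setT.

(* The parts are U_i = [set x | part x == i]. *)
Definition complete_multipartite (V : finType) (B : sgraph V) (k : nat)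
    (part : V -> 'I_k) : Prop :=
  (forall i, exists x, part x = i) /\
  (forall x y, adj B x y = (part x != part y)).

Definition interval_labeling (V : finType) (k : nat) (part : V -> 'I_k)
    (s : {perm 'I_k}) (phi : V -> 'I_#|V|) : Prop :=
  bijective phi /\
  (forall x y, s (part x) < s (part y) -> phi x < phi y).

Definition blowup_adj (V : finType) (B : sgraph V) (t : nat) : rel (V * 'I_t) :=
  fun u v => adj B u.1 v.1.

Lemma blowup_sym (V : finType) (B : sgraph V) (t : nat) :
  symmetric (@blowup_adj V B t).
Proof. by move=> u v; rewrite /blowup_adj adj_sym. Qed.

Lemma blowup_irrefl (V : finType) (B : sgraph V) (t : nat) :
  irreflexive (@blowup_adj V B t).
Proof. by move=> u; rewrite /blowup_adj adj_irrefl. Qed.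

(* The independent set V_x replacing x is [set u | u.1 == x]. *)
Definition blowup (V : finType) (B : sgraph V) (t : nat) : sgraph (V * 'I_t)%type :=
  SGraph (@blowup_sym V B t) (@blowup_irrefl V B t).

(* The vertex ordering of B(t) is given by the position [pos u] of each vertex.
   It may be arbitrary inside each V_x; as the vertices of V_x are twins, this
   does not affect [G], which is determined by B, phi and t. *)
Definition is_ordered_blowup (V : finType) (B : sgraph V) (phi : V -> 'I_#|V|)
    (t : nat) (G : ograph (#|V| * t)) : Prop :=
  exists pos : V * 'I_t -> 'I_(#|V| * t),
    [/\ bijective pos,
        (forall u v, phi u.1 < phi v.1 -> pos u < pos v) &
        (forall u v, adj G (pos u) (pos v) = adj (blowup B t) u v)].

(* The condition [0 < t] excludes the empty blow-up, which trivially has a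
   perfect tiling. *)
Definition bottlegraph (h : nat) (H : ograph h) (V : finType) (B : sgraph V)
    (k : nat) (part : V -> 'I_k) : Prop :=
  forall (s : {perm 'I_k}) (phi : V -> 'I_#|V|),
    interval_labeling part s phi ->
    exists t : nat, 0 < t /\
      exists2 G : ograph (#|V| * t),
        is_ordered_blowup B phi G & has_perfect_tiling H G.

(* Main.v *)
Require Import Defs.
From mathcomp Require Import all_boot all_order all_algebra all_fingroup.
From mathcomp Require Import reals.
From mathcomp Require Import zify ring lra.
Set Implicit Arguments.
Unset Strict Implicit.
Unset Printing Implicit Defensive.
Import Order.TTheory GRing.Theory Num.Theory.
Local Open Scope ring_scope.

(** Instead of the regularity lemma, split the vertices at random into blocks of
    a large constant size s.  By a second moment bound almost every vertex has
    about the expected number of non-neighbours in almost every block.  As long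
    as many blocks remain, the Kovari-Sos-Turan argument yields K disjoint
    families of m blocks such that the adjacency and the order between the a-th
    vertex of a block and the a'-th vertex of another one depend only on the two
    families, on a and on a'.  The a-th vertices of the blocks of a family form a
    cluster; two clusters of different families are completely joined or not
    joined at all, and in the first case one precedes the other.  The reduced
    graph on the Ks clusters inherits the degree condition, so every weighting of
    the clusters admits a light clique, found greedily as in Komlos' theorem;
    adding light cliques repeatedly balances the loads.  Each clique is an
    ordered blow-up of B, tiled by copies of H because B is a bottlegraph. *)

(** * Homogeneous boxes by the Kovari-Sos-Turan argument *)

Lemma exists_subset_card (T : finType) (A : {set T}) (m : nat) :
  (m <= #|A|)%N -> exists2 B : {set T}, B \subset A & #|B| = m.
Proof.
move=> mA; exists [set x in take m (enum A)].
  by apply/subsetP => x; rewrite inE => /mem_take; rewrite mem_enum.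
rewrite cardsE (card_uniqP _) ?take_uniq ?enum_uniq //.
by rewrite size_take -cardE; case: ltngtP mA.
Qed.

Lemma pigeonhole_card (X Y : finType) (f : X -> Y) (S : {set X}) (B : {set Y})
    (y0 : Y) :
  y0 \in B -> {in S, forall x, f x \in B} ->
  exists2 y, y \in B & (#|S| <= #|B| * #|[set x in S | f x == y]|)%N.
Proof.
move=> y0B fB.
pose F y := #|[set x in S | f x == y]|.
case: (@arg_maxnP _ y0 (mem B) F y0B) => y yB ymax.
exists y => //.
rewrite -sum1_card (partition_big f (mem B)) //=.
rewrite -sum_nat_const; apply: leq_sum => z zB.
by rewrite sum1_card; apply: leq_trans (ymax z zB); rewrite /F cardsE.
Qed.

(** Double counting: among boundedly many [x] of large degree, a positive proportion of all [y] find
    [m] neighbours, and one of the boundedly many [m]-sets serves many of these [y]. *)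
Lemma common_neighbourhood (X Y : finType) (r : X -> Y -> bool) (m D : nat) :
  (0 < m)%N -> (0 < D)%N ->
  (2 * D * (4 * m * D) <= #|X|)%N ->
  (#|X| * #|Y| <= D * \sum_x #|[set y | r x y]|)%N ->
  exists2 A : {set X}, #|A| = m &
    (#|Y| <= 4 * D * 2 ^ (4 * m * D) * #|[set y | [forall x in A, r x y]]|)%N.
Proof.
move=> m0 D0; set M := (4 * m * D)%N => XM dens.
pose deg x := #|[set y | r x y]|.
pose X1 := [set x | (#|Y| <= 2 * D * deg x)%N].
have X1M : (M <= #|X1|)%N.
  have [Y0|Y0] := posnP #|Y|.
    have -> : X1 = setT by apply/setP => x; rewrite !inE Y0.
    by rewrite cardsT; nia.
  have h1 : (\sum_x deg x <= #|X1| * #|Y| + \sum_(x | x \notin X1) deg x)%N.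
    rewrite (bigID (mem X1)) /= leq_add2r -sum_nat_const.
    by apply: leq_sum => x _; apply: max_card.
  have h2 : (2 * D * \sum_(x | x \notin X1) deg x <= #|X| * #|Y|)%N.
    rewrite big_distrr /= -sum_nat_const.
    apply: (@leq_trans (\sum_(x | x \notin X1) #|Y|)).
      by apply: leq_sum => x; rewrite inE -ltnNge => /ltnW.
    by rewrite [X in (_ <= X)%N](bigID (mem X1)) /= leq_addl.
  have h3 : (#|X| * #|Y| <= 2 * D * #|X1| * #|Y|)%N.
    have {}dens : (#|X| * #|Y| <= D * \sum_x deg x)%N := dens.
    have h4 := leq_mul (leqnn D) h1; rewrite mulnDr in h4; lia.
  rewrite leq_pmul2r // in h3.
  by have := leq_trans XM h3; rewrite leq_pmul2l // muln_gt0.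
(* Only [M] vertices of large degree are kept, so that the final pigeonhole has at most [2 ^ M]
   candidate sets, a bound free of [#|X|]. *)
have [X0 X01 X0M] := exists_subset_card X1M.
pose d0 y := #|[set x in X0 | r x y]|.
have sumd0 : \sum_(x in X0) deg x = \sum_y d0 y.
  rewrite (eq_bigr (fun x => \sum_(y | r x y) 1)%N); last first.
    by move=> x _; rewrite /deg -sum1_card; apply: eq_bigl => y; rewrite inE.
  rewrite (exchange_big_dep predT) //=; apply: eq_bigr => y _.
  by rewrite /d0 -sum1_card; apply: eq_bigl => x; rewrite inE.
have lo : (M * #|Y| <= 2 * D * \sum_y d0 y)%N.
  rewrite -sumd0 big_distrr /= -X0M -sum_nat_const; apply: leq_sum => x xX.
  by have := subsetP X01 x xX; rewrite inE.
pose Yg := [set y | (m <= d0 y)%N].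
have hi : (\sum_y d0 y <= m * #|Y| + M * #|Yg|)%N.
  rewrite (bigID (mem Yg)) /= addnC; apply: leq_add.
    apply: (@leq_trans (\sum_(y | y \notin Yg) m)).
      by apply: leq_sum => y; rewrite inE -ltnNge => /ltnW.
    by rewrite sum_nat_const mulnC leq_mul2l max_card orbT.
  rewrite mulnC -sum_nat_const; apply: leq_sum => y _.
  by rewrite -X0M; apply/subset_leq_card/subsetP => x; rewrite inE => /andP[].
have YYg : (#|Y| <= 4 * D * #|Yg|)%N.
  have h4 := leq_mul (leqnn (2 * D)) hi.
  have h5 : (2 * D * m * #|Y| <= 2 * D * m * (4 * D * #|Yg|))%N.
    rewrite /M in lo h4; lia.
  by rewrite leq_pmul2l ?muln_gt0 ?D0 // in h5.
have mX0 : (m <= #|X0|)%N by rewrite X0M /M; nia.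
pose Bs := [set A : {set X} | (A \subset X0) && (#|A| == m)].
have [A0 A0X /eqP A0m] := exists_subset_card mX0.
have A0B : A0 \in Bs by rewrite inE A0X.
pose F y := odflt A0 [pick A in Bs | [forall x in A, r x y]].
have FB : {in Yg, forall y, F y \in Bs}.
  by move=> y _; rewrite /F; case: pickP => [A /andP[]|].
have [A AB AP] := pigeonhole_card A0B FB.
exists A; first by move: AB; rewrite inE => /andP[_ /eqP].
have Bcard : (#|Bs| <= 2 ^ M)%N.
  rewrite -X0M -card_powerset; apply/subset_leq_card/subsetP => C.
  by rewrite !inE => /andP[].
apply: leq_trans YYg _; rewrite -!mulnA !leq_mul2l; apply/orP; right; apply/orP; right.
apply: leq_trans AP _; apply: leq_mul => //.
apply/subset_leq_card/subsetP => y; rewrite !inE => /andP[my /eqP <-].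
rewrite /F; case: pickP => [C /andP[] //|] none.
have [C CX /eqP Cm] := exists_subset_card my.
have /negP[] := none C; rewrite !inE Cm andbT; apply/andP; split.
  by apply: subset_trans CX _; apply/subsetP => x; rewrite inE => /andP[].
by apply/forall_inP => x /(subsetP CX); rewrite inE => /andP[].
Qed.

(** Induction on [q]: splitting off the first entry makes [P] a bipartite relation between [T] and
    the [q]-tuples. [common_neighbourhood] gives the first side, and the tuples compatible with all
    of it have the smaller density passed to the induction hypothesis. *)
Lemma dense_box (q m D : nat) : (0 < m)%N -> (0 < D)%N ->
  exists N0, forall (T : finType) (P : seq T -> bool), (N0 <= #|T|)%N ->
    (#|T| ^ q <= D * #|[set t : q.-tuple T | P t]|)%N ->
    exists As : seq {set T}, [/\ size As = q, (forall A : {set T}, A \in As -> #|A| = m) &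
      forall t, all2 (fun x (A : {set T}) => x \in A) t As -> P t].
Proof.
move=> m0; elim: q D => [|q IHq] D D0.
  exists 0%N => T P _; rewrite expn0 muln_gt0 D0 /= => /card_gt0P[t].
  by rewrite inE tuple0 => P0; exists [::]; split=> // -[].
have [|N0 HN0] := IHq (4 * D * 2 ^ (4 * m * D))%N.
  by rewrite !muln_gt0 D0 expn_gt0.
exists (maxn N0 (2 * D * (4 * m * D))) => T P; rewrite geq_max => /andP[NT MT] dens.
have [|A Am AP] := @common_neighbourhood T (q.-tuple T) (fun x t => P (x :: t)) m D m0 D0 MT.
- rewrite card_tuple -expnS; apply: leq_trans dens _.
  rewrite leq_mul2l -!sum1_card (partition_big (fun t : q.+1.-tuple T => thead t) predT) //=.
  apply/orP; right; apply: leq_sum => x _; rewrite !sum1_card.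
  rewrite -(card_in_imset (f := fun t : q.+1.-tuple T => [tuple of behead t])).
    apply/subset_leq_card/subsetP => _ /imsetP[t + ->].
    rewrite unfold_in /= !inE => /andP[Pt /eqP <-].
    by move: Pt; rewrite (tuple_eta t).
  move=> t u; rewrite !unfold_in /= => /andP[_ /eqP tx] /andP[_ /eqP ux] tu.
  by rewrite (tuple_eta t) (tuple_eta u) tx ux; apply/val_inj; congr (_ :: _); case: tu.
have [|As [Asq Asm AsP]] := HN0 T (fun t => [forall x in A, P (x :: t)]) NT.
  by rewrite -card_tuple.
exists (A :: As); split=> /=; first by rewrite Asq.
  by move=> C; rewrite inE => /predU1P[->|/Asm].
by move=> [|x t] //= /andP[xA /AsP /forall_inP]; apply.
Qed.

Lemma dense_box_ffun (q m D : nat) : (0 < m)%N -> (0 < D)%N ->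
  exists N0, forall (T : finType) (P : pred {ffun 'I_q -> T}), (N0 <= #|T|)%N ->
    (#|T| ^ q <= D * #|[set f | P f]|)%N ->
    exists A : 'I_q -> {set T}, (forall p, #|A p| = m) /\
      forall f : {ffun 'I_q -> T}, (forall p, f p \in A p) -> P f.
Proof.
move=> m0 D0; have [N0 HN0] := dense_box q m0 D0.
exists N0 => T P NT dens.
pose tup (f : {ffun 'I_q -> T}) := [tuple f i | i < q].
have tup_inj : injective tup.
  move=> f g fg; apply/ffunP => p.
  by have := congr1 (fun t => tnth t p) fg; rewrite !tnth_mktuple.
pose P' s := [exists f, (val (tup f) == s) && P f].
have [|As [Asq Asm AsP]] := HN0 T P' NT.
  apply: leq_trans dens _; rewrite leq_mul2l; apply/orP; right.
  rewrite -(card_imset _ tup_inj); apply/subset_leq_card/subsetP => _ /imsetP[f + ->].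
  by rewrite !inE => Pf; apply/existsP; exists f; rewrite eqxx.
exists (fun p => nth set0 As p); split=> [p|f fA].
  by apply: Asm; rewrite mem_nth // Asq.
have : P' (tup f).
  apply: AsP; rewrite all2E size_tuple Asq eqxx /=.
  apply/allP => -[x C] /(nthP (x, C))[i]; have sz : size (val (tup f)) = q by rewrite size_tuple.
  rewrite size1_zip ?sz ?Asq // => iq.
  rewrite nth_zip ?sz ?Asq // (nth_mktuple _ _ (Ordinal iq)) => -[<- <-] /=.
  by rewrite (set_nth_default set0) ?Asq //; apply: (fA (Ordinal iq)).
by case/existsP => g /andP[/eqP/val_inj/tup_inj ->].
Qed.

(** For a random [f] the pair [(f p, f p')] is uniform; the count uses the injection that exchanges
    an outer pair with the values of [f] at [p] and [p']. *)
Lemma card_ffun_pair (q : nat) (T : finType) (r : rel T) (p p' : 'I_q) :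
  p != p' ->
  (#|T| ^ 2 * #|[set f : {ffun 'I_q -> T} | r (f p) (f p')]| <=
    #|[set u : T * T | r u.1 u.2]| * #|T| ^ q)%N.
Proof.
move=> pp'.
have -> : (#|T| ^ q)%N = #|[set: {ffun 'I_q -> T}]|.
  by rewrite cardsT card_ffun card_ord.
have -> : (#|T| ^ 2)%N = #|[set: T * T]| by rewrite cardsT card_prod mulnn.
rewrite -!cardsX.
pose up (f : {ffun 'I_q -> T}) (u : T * T) : {ffun 'I_q -> T} :=
  [ffun i => if i == p then u.1 else if i == p' then u.2 else f i].
pose F (w : (T * T) * {ffun 'I_q -> T}) := ((w.2 p, w.2 p'), up w.2 w.1).
have F_inj : injective F.
  move=> [[u1 u2] f] [[v1 v2] g] [fp fp' fg].
  have E i : up f (u1, u2) i = up g (v1, v2) i by rewrite fg.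
  have := E p; have := E p'.
  rewrite !ffunE eqxx /= eq_sym (negbTE pp') eqxx => -> ->; congr pair.
  apply/ffunP => i; have := E i; rewrite !ffunE.
  by have [->|_] := eqVneq i p => //; have [->|_] := eqVneq i p'.
rewrite -(card_imset _ F_inj); apply/subset_leq_card/subsetP => _ /imsetP[w + ->].
by rewrite !inE /= andbT.
Qed.

(** By a union bound over pairs of coordinates, at least half of the functions avoid [bad]. As the
    number of colour patterns is bounded, one pattern has positive density among them, and
    [dense_box_ffun] finds a box of functions with this pattern. *)
Lemma homogeneous_box (q m c : nat) : (0 < m)%N ->
  exists N0, forall (T K : finType) (bad : rel T) (col : T -> T -> K) (k0 : K),
    (N0 <= #|T|)%N -> (#|K| <= c)%N ->
    (2 * q ^ 2 * #|[set u : T * T | bad u.1 u.2]| <= #|T| ^ 2)%N ->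
    exists (A : 'I_q -> {set T}) (gam : 'I_q -> 'I_q -> K),
      (forall p, #|A p| = m) /\
      forall p p', p != p' -> {in A p & A p', forall x y,
        ~~ bad x y /\ col x y = gam p p'}.
Proof.
move=> m0.
have [|N0 HN0] := @dense_box_ffun q m (2 * c.+1 ^ (q * q)) m0.
  by rewrite muln_gt0 expn_gt0.
exists N0.+1 => T K bad col k0 NT Kc badT.
have T0 : (0 < #|T|)%N by apply: leq_trans NT.
pose Bp (u : 'I_q * 'I_q) :=
  [set f : {ffun 'I_q -> T} | (u.1 != u.2) && bad (f u.1) (f u.2)].
pose Bad := \bigcup_u Bp u.
have Bad_le : (2 * #|Bad| <= #|T| ^ q)%N.
  have h1 : (#|T| ^ 2 * #|Bad| <= \sum_u #|T| ^ 2 * #|Bp u|)%N.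
    rewrite -big_distrr /= leq_mul2l; apply/orP; right.
    apply: (big_ind2 (fun (A : {set {ffun 'I_q -> T}}) a => (#|A| <= a)%N)) => //.
      by rewrite cards0.
    move=> A a C b Aa Cb; apply: leq_trans (leq_card_setU A C) _.
    exact: leq_add.
  have h2 : (\sum_u #|T| ^ 2 * #|Bp u| <=
     (q * q) * (#|[set u : T * T | bad u.1 u.2]| * #|T| ^ q))%N.
    have -> : (q * q)%N = #|{: 'I_q * 'I_q}| by rewrite card_prod card_ord.
    rewrite -(sum_nat_const {: 'I_q * 'I_q}).
    apply: leq_sum => -[p p'] _; have [->|pp'] := eqVneq p p'.
      by rewrite /Bp /= eqxx (_ : [set _ | _] = set0) ?cards0 ?muln0 //; apply/setP => f; rewrite !inE.
    by rewrite /Bp /= pp' card_ffun_pair.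
  have T2 : (0 < #|T| ^ 2)%N by rewrite expn_gt0 T0.
  rewrite -(leq_pmul2l T2).
  have h3 := leq_mul badT (leqnn (#|T| ^ q)).
  have h4 := leq_trans h1 h2; rewrite mulnn in h4; lia.
pose gamf (f : {ffun 'I_q -> T}) : {ffun 'I_q * 'I_q -> K} :=
  [ffun u => col (f u.1) (f u.2)].
have Good_ge : (#|T| ^ q <= 2 * #|~: Bad|)%N.
  by have := cardsC Bad; rewrite card_ffun card_ord; lia.
have [||gam _ gamP] := @pigeonhole_card _ _ gamf (~: Bad) setT [ffun=> k0].
- by [].
- by [].
have [||A [Am AP]] := HN0 T [pred f | (f \notin Bad) && (gamf f == gam)].
- exact: ltnW.
- apply: leq_trans Good_ge _; rewrite -mulnA leq_mul2l /=.
  apply: leq_trans gamP _; apply: leq_mul.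
    rewrite cardsT card_ffun card_prod !card_ord; have [->|e0] := posnP (q * q); first by rewrite !expn0.
    by rewrite leq_exp2r // leqW.
  by apply/subset_leq_card/subsetP => f; rewrite !inE.
exists A, (fun p p' => gam (p, p')); split=> // p p' pp' x y xA yA.
have Ane i : exists z, z \in A i by apply/card_gt0P; rewrite Am.
(* Any [x] and [y] on two sides of the box extend to a function in the box, so they inherit its
   pattern. *)
pose f := [ffun i => if i == p then x else if i == p' then y else xchoose (Ane i)].
have /AP : forall i, f i \in A i.
  move=> i; rewrite ffunE; have [->//|_] := eqVneq i p.
  have [->//|_] := eqVneq i p'; exact: (xchooseP (Ane i)).
have fp : f p = x by rewrite ffunE eqxx.
have fp' : f p' = y by rewrite ffunE eq_sym (negbTE pp') eqxx.
move=> /andP[fB /eqP <-]; rewrite ffunE /= fp fp'; split=> //.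
apply: contra fB => bxy; apply/bigcupP; exists (p, p') => //.
by rewrite inE /= pp' fp fp'.
Qed.

(** * Light cliques and balanced loads *)

(* [v 0], ..., [v t.-1] are chosen greedily of minimal weight among the common
   neighbours of the previous ones, and [C] is the set of common neighbours. *)
Lemma greedy_clique (W : finType) (E : rel W) (a : nat) (y : W -> nat) (t : nat) :
  symmetric E -> (forall w, #|[set u | ~~ E w u]| <= a)%N ->
  (t * a < #|W|)%N ->
  exists (v : nat -> W) (C : {set W}), [/\ (#|W| <= #|C| + t * a)%N,
    (forall i j, i < j < t -> E (v i) (v j))%N,
    (forall i u, i < t -> u \in C -> E (v i) u && (y (v i) <= y u))%N &
    forall Z, (forall i, i < t -> y (v i) <= Z)%N ->
      (a * (\sum_(i < t) y (v i)) + #|W| * Z <=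
        \sum_(u | u \notin C) y u + #|C| * Z + t * a * Z)%N].
Proof.
move=> Esym Ea; elim: t => [|t IHt] ta.
  have /card_gt0P[w _] : (0 < #|W|)%N by apply: leq_ltn_trans ta.
  exists (fun=> w), setT; split=> //.
  - by rewrite cardsT leq_addr.
  - by move=> i j; rewrite ltn0 andbF.
  by move=> Z _; rewrite big_ord0 cardsT !mul0n muln0 addn0 leq_addl.
have [|v [C [CW vE vC vZ]]] := IHt; first by apply: leq_ltn_trans ta; rewrite leq_mul2r leqnSn orbT.
have /card_gt0P[x0 x0C] : (0 < #|C|)%N by rewrite mulSn in ta; lia.
case: (@arg_minnP _ x0 (mem C) y x0C) => x xC xmin.
pose v' i := if i == t then x else v i.
have v'E i : (i < t)%N -> v' i = v i by rewrite /v' => it; rewrite ltn_eqF.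
have v't : v' t = x by rewrite /v' eqxx.
pose N := [set u | E x u].
exists v', (C :&: N).
have CN : (#|C| = #|C :&: N| + #|C :\: N|)%N by rewrite cardsID.
have CNa : (#|C :\: N| <= a)%N.
  apply: leq_trans (Ea x); apply/subset_leq_card/subsetP => u.
  by rewrite !inE => /andP[].
split.
- by rewrite mulSn; lia.
- move=> i j; rewrite ltnS (leq_eqVlt j) => /andP[ij /predU1P[jt|jt]].
    rewrite jt in ij *; rewrite v't v'E //.
    by have /andP[] := vC i x ij xC.
  by rewrite !v'E ?(ltn_trans ij) //; apply: vE; rewrite ij.
- move=> i u; rewrite ltnS leq_eqVlt => /predU1P[->|it]; rewrite !inE => /andP[uC xu].
    by rewrite v't xu xmin.
  by rewrite v'E // vC.
move=> Z Zge.
have xZ : (y x <= Z)%N by rewrite -v't Zge.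
(* In the last bound each [v i] accounts for [a] removed vertices of weight at least [y (v i)], and
   the [#|C| + t * a - #|W|] vertices not really removed are charged [Z] each. The induction
   hypothesis is taken at [y x], the largest weight so far; since the number of charged vertices is
   nonnegative, [y x] can then be raised to [Z]. *)
have := vZ (y x) (fun i it => proj2 (andP (vC i x it xC))).
rewrite big_ord_recr /= v't.
under [in X in _ -> X]eq_bigr => i _ do rewrite v'E //.
have -> : (\sum_(u | u \notin C :&: N) y u =
    \sum_(u | u \notin C) y u + \sum_(u in C :\: N) y u)%N.
  rewrite (bigID (mem C)) /= addnC; congr (_ + _)%N; apply: eq_bigl => u.
    by rewrite !inE; case: (u \in C); case: (E x u).
  by rewrite !inE andbC; case: (u \in C); case: (E x u).
have : (#|C :\: N| * y x <= \sum_(u in C :\: N) y u)%N.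
  by rewrite -sum_nat_const; apply: leq_sum => u; rewrite inE => /andP[_ /xmin].
have : (#|W| <= #|C :&: N| + t.+1 * a)%N by rewrite mulSn; lia.
rewrite CN mulSn => h0 h1 h2; have := leq_mul h0 (leqnn (Z - y x)).
have -> : Z = (y x + (Z - y x))%N by rewrite subnKC.
move: h1 h2 {h0}; rewrite addKn.
move: (Z - y x)%N (y x) (\sum_(i < t) y (v i))%N (\sum_(u in _) y u)%N => e z s s'.
move: (\sum_(u | u \notin C) y u)%N #|C :&: N| #|C :\: N| #|W| => s'' p d w.
nia.
Qed.

(** Summing over all cyclic shifts [c] gives exactly the product on the right, and the best shift is
    no worse than the average. *)
Lemma sum_shift_le (r : nat) (b : 'I_r.+1 -> nat) (z : 'I_r.+1 -> nat) :
  exists c : 'I_r.+1,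
    (r.+1 * \sum_j b j * z (j + c)%R <= (\sum_j b j) * \sum_j z j)%N.
Proof.
pose F c := (\sum_j b j * z (j + c)%R)%N.
case: (@arg_minnP _ ord0 predT F isT) => c _ cmin; exists c.
have -> : ((\sum_j b j) * \sum_j z j = \sum_c F c)%N.
  rewrite /F exchange_big /= big_distrl /=; apply: eq_bigr => j _.
  by rewrite -big_distrr /= [in LHS](reindex_inj (addrI j)).
by rewrite -[X in (X * _)%N]card_ord -sum_nat_const; apply: leq_sum => d _; apply: cmin.
Qed.

(** The greedy clique is completed by a lightest vertex [x] of [C], which is the heaviest of the
    clique and gets the multiplicity [b i0]; the best cyclic shift distributes the others over [v].
    When [b i0] is the smallest part, the last hypothesis is the degree condition given by the
    critical chromatic number. *)
Lemma weighted_clique (W : finType) (E : rel W) (r : nat) (b : 'I_r.+2 -> nat)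
    (i0 : 'I_r.+2) (a : nat) (y : W -> nat) :
  symmetric E -> (0 < b i0)%N -> (0 < #|W|)%N ->
  (forall w, #|[set u | ~~ E w u]| <= a)%N ->
  (r.+1 * a * \sum_i b i <= (\sum_i b i - b i0) * #|W|)%N ->
  exists tau : {ffun 'I_r.+2 -> W}, (forall i j, i != j -> E (tau i) (tau j)) /\
    (#|W| * \sum_i b i * y (tau i) <= (\sum_i b i) * \sum_w y w)%N.
Proof.
move=> Esym b0 W0 Ea; set B := (\sum_i b i)%N => Ba.
have Bi0 : (b i0 <= B)%N by rewrite /B (bigD1 i0) //= leq_addr.
have ta : (r.+1 * a < #|W|)%N by nia.
have [v [C [CW vE vC vZ]]] := greedy_clique y Esym Ea ta.
have /card_gt0P[x0 x0C] : (0 < #|C|)%N by lia.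
case: (@arg_minnP _ x0 (mem C) y x0C) => x xC xmin.
pose b' j := b (lift i0 j).
have [c cP] := sum_shift_le b' (fun j => y (v j)).
pose tau : {ffun 'I_r.+2 -> W} := [ffun i => if unlift i0 i is Some j then v (j + c)%R else x].
have taul j : tau (lift i0 j) = v (j + c)%R by rewrite ffunE liftK.
have tau0 : tau i0 = x by rewrite ffunE unlift_none.
exists tau; split.
  have E0 j : E (tau (lift i0 j)) (tau i0).
    by rewrite taul tau0; have /andP[] := vC (j + c)%R x (ltn_ord _) xC.
  move=> i j; have [i1 ->|->] := unliftP i0 i; have [j1 ->|->] := unliftP i0 j.
  - rewrite (inj_eq lift_inj) !taul => ij.
    have : (j1 + c)%R != (i1 + c)%R by rewrite (inj_eq (addIr c)) eq_sym.
    rewrite -val_eqE neq_ltn => /orP[] lt; last by apply: vE; rewrite lt ltn_ord.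
    by rewrite Esym; apply: vE; rewrite lt ltn_ord.
  - by move=> _; apply: E0.
  - by move=> _; rewrite Esym; apply: E0.
  by rewrite eqxx.
have Bsum : B = (b i0 + \sum_j b' j)%N by rewrite /B (bigD1_ord i0).
rewrite (bigD1_ord i0) //= tau0.
under eq_bigr => j _ do rewrite taul.
have vx i : (i < r.+1)%N -> (y (v i) <= y x)%N.
  by move=> ir; have /andP[] := vC i x ir xC.
have Zx : (\sum_(j < r.+1) y (v j) <= r.+1 * y x)%N.
  by rewrite -[X in (_ <= X * _)%N]card_ord -sum_nat_const; apply: leq_sum => j _; apply: vx.
have Sx : (\sum_(u | u \notin C) y u + #|C| * y x <= \sum_u y u)%N.
  rewrite [leqRHS](bigID (mem C)) /= addnC leq_add2r -sum_nat_const.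
  by apply: leq_sum => u /xmin.
have := vZ _ vx; move: cP Ba Zx Sx; rewrite -/b'.
rewrite Bsum addKn.
move: (\sum_j b' j)%N (\sum_(j < r.+1) y (v j))%N (\sum_(j < r.+1) b' j * y (v (j + c)%R))%N => B' Z X.
move: (\sum_u y u)%N (\sum_(u | u \notin C) y u)%N (y x) (b i0) => S S' z s.
move: #|C| #|W| r.+1 (ltn0Sn r) => nC nW q q0 cP Ba Zx Sx main.
rewrite -(leq_pmul2l q0).
have h1 : (a * Z + nW * z <= S + q * a * z)%N by lia.
have h2 := leq_mul (leqnn (q * (s + B'))) h1.
have h3 := leq_mul (leqnn nW) cP.
(* The claim reduces to [Z <= q * z] multiplied by this difference, which is not truncated by [Ba],
   as [h5] records. *)
have h4 : ((nW * B' - q * a * (s + B')) * Z <= (nW * B' - q * a * (s + B')) * (q * z))%N.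
  by rewrite leq_mul2l Zx orbT.
have h5 : (nW * B' = (nW * B' - q * a * (s + B')) + q * a * (s + B'))%N by lia.
move: h4 h5; move: (nW * B' - q * a * (s + B'))%N => Dl h4 h5.
nia.
Qed.

Definition tile_load (W : finType) (k : nat) (b : 'I_k -> nat)
    (ts : seq {ffun 'I_k -> W}) (w : W) : nat :=
  \sum_(tau <- ts) \sum_i b i * (tau i == w).

Section TileLoad.
Variables (W : finType) (k : nat) (b : 'I_k -> nat).
Implicit Types (ts : seq {ffun 'I_k -> W}) (tau : {ffun 'I_k -> W}).

Lemma tile_load_cons tau ts w :
  tile_load b (tau :: ts) w = (\sum_i b i * (tau i == w) + tile_load b ts w)%N.
Proof. by rewrite /tile_load big_cons. Qed.

Lemma sum_weight_tile tau (y : W -> nat) :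
  (\sum_w (\sum_i b i * (tau i == w)) * y w = \sum_i b i * y (tau i))%N.
Proof.
under eq_bigr => w _ do rewrite big_distrl /=.
rewrite exchange_big /=; apply: eq_bigr => i _.
rewrite (bigD1 (tau i)) //= eqxx muln1 big1 ?addn0 // => w wi.
by rewrite eq_sym (negbTE wi) muln0.
Qed.

Lemma sum_tile_load ts : (\sum_w tile_load b ts w = (\sum_i b i) * size ts)%N.
Proof.
rewrite exchange_big /= -[in RHS]sum1_size big_distrr /=; apply: eq_bigr => tau _.
rewrite big_distrl /= -(sum_weight_tile tau (fun=> 1%N)).
by apply: eq_bigr => w _; rewrite muln1.
Qed.

Lemma tile_weight_le tau w : (\sum_i b i * (tau i == w) <= \sum_i b i)%N.
Proof. by apply: leq_sum => i _; case: eqP => _ /=; rewrite ?muln1 ?muln0. Qed.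

End TileLoad.

(* Always adding a tile which is light for the current loads keeps the sum of
   the squared loads near its minimum. *)
Lemma greedy_tiles (W : finType) (E : rel W) (r : nat) (b : 'I_r.+2 -> nat)
    (i0 : 'I_r.+2) (a T : nat) :
  symmetric E -> (0 < b i0)%N -> (0 < #|W|)%N ->
  (forall w, #|[set u | ~~ E w u]| <= a)%N ->
  (r.+1 * a * \sum_i b i <= (\sum_i b i - b i0) * #|W|)%N ->
  exists ts : seq {ffun 'I_r.+2 -> W}, [/\ size ts = T,
    {in ts, forall tau : {ffun 'I_r.+2 -> W}, forall i j, i != j -> E (tau i) (tau j)} &
    (#|W| * \sum_w tile_load b ts w ^ 2 <=
      (\sum_i b i * T) ^ 2 + #|W| * (\sum_i b i) ^ 2 * T)%N].
Proof.
move=> Esym b0 W0 Ea Ba; set B := (\sum_i b i)%N in Ba *.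
elim: T => [|T [ts [tsT tsE tsS]]].
  exists [::]; split=> //.
  by rewrite big1 ?muln0 // => w _; rewrite /tile_load big_nil.
have [tau [tauE tauW]] := weighted_clique (tile_load b ts) Esym b0 W0 Ea Ba.
exists (tau :: ts); split=> /=; first by rewrite tsT.
  by move=> t; rewrite inE => /predU1P[->|/tsE].
pose e w := (\sum_i b i * (tau i == w))%N.
have {}tauW : (#|W| * \sum_w e w * tile_load b ts w <= B * (B * T))%N.
  by rewrite /e sum_weight_tile -tsT -sum_tile_load.
have eB : (\sum_w e w ^ 2 <= B ^ 2)%N.
  have -> : (B ^ 2 = \sum_w e w * B)%N.
    by rewrite /e sum_weight_tile -big_distrl.
  by apply: leq_sum => w _; rewrite expnS expn1 leq_mul2l tile_weight_le orbT.
have -> : (\sum_w tile_load b (tau :: ts) w ^ 2 =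
    \sum_w e w ^ 2 + 2 * \sum_w e w * tile_load b ts w +
    \sum_w tile_load b ts w ^ 2)%N.
  rewrite big_distrr -!big_split /=; apply: eq_bigr => w _.
  by rewrite tile_load_cons sqrnD -/(e w); ring.
have -> : (\sum_i b i * T.+1 = \sum_i b i * T + B)%N.
  by rewrite -big_distrl -[in RHS]big_distrl /= -/B mulnS addnC.
have BT : (\sum_i b i * T = B * T)%N by rewrite -big_distrl.
rewrite BT in tsS *.
move: tsS tauW eB.
move: (\sum_w e w ^ 2)%N (\sum_w e w * _)%N (\sum_w _ ^ 2)%N => s1 s2 s3 h1 h2 h3.
have h4 := leq_mul (leqnn #|W|) h3.
rewrite -!mulnn in h1 h4 *; move: h1 h2 h4 {tsE tauE e BT Ba h3}; move: #|W| B => w C h1 h2 h4; lia.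
Qed.

(** The number of tiles makes the mean load [M] equal to [B * Q * g ^ 2], with [B] the sum of [b].
    The sum of squares exceeds its minimum by at most [(B * Q * g) ^ 2], so no load exceeds the mean
    by more than [B * Q * g], a fraction [1 / g] of it. *)
Lemma balanced_tiles (W : finType) (E : rel W) (r : nat) (b : 'I_r.+2 -> nat)
    (i0 : 'I_r.+2) (a Q g : nat) :
  symmetric E -> (0 < b i0)%N -> (0 < #|W| <= Q)%N ->
  (forall w, #|[set u | ~~ E w u]| <= a)%N ->
  (r.+1 * a * \sum_i b i <= (\sum_i b i - b i0) * #|W|)%N ->
  exists ts : seq {ffun 'I_r.+2 -> W}, [/\ size ts = (#|W| * (Q * g ^ 2))%N,
    {in ts, forall tau : {ffun 'I_r.+2 -> W}, forall i j, i != j -> E (tau i) (tau j)} &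
    forall w, (tile_load b ts w <= (\sum_i b i) * Q * g * g.+1)%N].
Proof.
move=> Esym b0 /andP[W0 WQ] Ea Ba.
have [ts [tsT tsE tsS]] := greedy_tiles (#|W| * (Q * g ^ 2)) Esym b0 W0 Ea Ba.
exists ts; split=> // w0; move: tsS; rewrite -big_distrl /=.
have := sum_tile_load b ts; rewrite tsT.
set B := (\sum_i b i)%N; set l := tile_load b ts.
pose M := (B * (Q * g ^ 2))%N; move=> lB lS.
have [lM|Ml] := leqP (l w0) M.
  by apply: leq_trans lM _; rewrite /M -mulnn !mulnA leq_mul2l leqnSn orbT.
(* This sums [2 * M * l w <= l w ^ 2 + M ^ 2] over all [w], keeping the defect of the inequality at
   [w0]. *)
have var : (2 * M * (\sum_w l w) + (l w0 - M) ^ 2 <= \sum_w l w ^ 2 + #|W| * M ^ 2)%N.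
  rewrite -(sum_nat_const W) -big_split big_distrr /= (bigD1 w0) //=.
  rewrite [leqRHS](bigD1 w0) //= addnAC; apply: leq_add.
    have -> : l w0 = (M + (l w0 - M))%N by rewrite subnKC // ltnW.
    by rewrite addKn -!mulnn; nia.
  by apply: leq_sum => w _; rewrite -mulnA [(M * _)%N]mulnC nat_Cauchy.
have main : ((l w0 - M) ^ 2 <= (B * Q * g) ^ 2)%N.
  rewrite -(leq_pmul2l W0).
  have h1 := leq_mul (leqnn #|W|) var; rewrite lB in h1.
  have h2 : (#|W| * B ^ 2 * (#|W| * (Q * g ^ 2)) <= #|W| * (B * Q * g) ^ 2)%N.
    have -> : (#|W| * (B * Q * g) ^ 2 = #|W| * B ^ 2 * (Q * (Q * g ^ 2)))%N.
      by rewrite -!mulnn; ring.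
    by rewrite leq_mul2l leq_mul2r WQ !orbT.
  have BM : (B * (#|W| * (Q * g ^ 2)) = #|W| * M)%N by rewrite /M mulnCA.
  rewrite BM in lS h1; apply: leq_trans h2; move: lS h1.
  move: (\sum_w _)%N (l w0 - M)%N (Q * g ^ 2)%N #|W| (B ^ 2)%N => S2 d q w c.
  clear; move: M => M lS h1; rewrite -!mulnn in lS h1 *; lia.
rewrite leq_exp2r // in main.
rewrite leq_subLR in main; apply: leq_trans main _.
by rewrite /M -mulnn mulnS !mulnA addnC.
Qed.

(** * Second moments under a random permutation *)

Lemma perm_two_transitive (T : finType) (e e' d d' : T) :
  e != e' -> d != d' -> exists t : {perm T}, t e = d /\ t e' = d'.
Proof.
move=> ee' dd'; exists (tperm e d * tperm (tperm e d e') d')%g.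
rewrite !permM tpermL tpermL; split=> //; apply: tpermD; rewrite ?[d' == _]eq_sym //.
by rewrite -{2}(tpermL e d) (inj_eq perm_inj) eq_sym.
Qed.

Section RandomPermutation.
Variable R : realFieldType.

(** Two distinct positions are negatively correlated: by two-transitivity all pairs give the same
    sum, while for a fixed [s] the products over all pairs add up to minus the sum of the squares of
    [f], because [f] has sum 0. *)
Lemma sum_perm_pair_le0 (T : finType) (f : T -> R) (e e' : T) :
  e != e' -> \sum_u f u = 0 -> \sum_(s : {perm T}) f (s e) * f (s e') <= 0.
Proof.
move=> ee' f0; pose C d d' := \sum_(s : {perm T}) f (s d) * f (s d').
have CC d d' : d != d' -> C d d' = C e e'.
  move=> dd'; have [t [te te']] := perm_two_transitive ee' dd'.
  rewrite [RHS](reindex_inj (mulgI t)); apply: eq_bigr => s _.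
  by rewrite !permM te te'.
have : \sum_d \sum_(d' | d != d') C d d' <= 0.
  have -> : \sum_d \sum_(d' | d != d') C d d' =
      \sum_(s : {perm T}) \sum_d \sum_(d' | d != d') f (s d) * f (s d').
    rewrite [RHS]exchange_big; apply: eq_bigr => d _.
    by rewrite [RHS]exchange_big.
  apply: sumr_le0 => s _.
  have fs0 : \sum_d f (s d) = 0 by rewrite -[RHS]f0 [RHS](reindex_inj (@perm_inj _ s)).
  have E d : \sum_(d' | d != d') f (s d) * f (s d') = - f (s d) ^+ 2.
    rewrite -mulr_sumr.
    have := fs0; rewrite (bigD1 d) //= => /eqP; rewrite addr_eq0 => /eqP fd.
    rewrite (eq_bigl (fun i => i != d)) => [|i]; last by rewrite eq_sym.
    by rewrite fd sqrrN expr2 mulNr.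
  rewrite (eq_bigr _ (fun d _ => E d)); apply: sumr_le0 => d _.
  by rewrite oppr_le0 sqr_ge0.
have -> : \sum_d \sum_(d' | d != d') C d d' = \sum_(d : T) \sum_(d' | d != d') C e e'.
  by apply: eq_bigr => d _; apply: eq_bigr => d' /CC.
rewrite pair_big_dep sumr_const -/(C e e') => le0; rewrite leNgt; apply/negP => gt0.
have : (0 < C e e' *+ #|[pred p : T * T | p.1 != p.2]|)%R.
  by rewrite pmulrn_lgt0 //; apply/card_gt0P; exists (e, e').
by rewrite ltNge le0.
Qed.

Lemma exists_le_average (T : finType) (G : T -> R) (c : R) :
  (0 < #|T|)%N -> \sum_x G x <= #|T|%:R * c -> exists x, G x <= c.
Proof.
move=> T0 Gc; apply/existsP; apply: contraT; rewrite negb_exists => /forallP H.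
have : \sum_(x : T) c < \sum_x G x.
  have /card_gt0P[x0 _] := T0.
  apply: ltr_sum; first by apply/hasP; exists x0; rewrite ?mem_index_enum.
  by move=> x _; rewrite ltNge.
by rewrite sumr_const mulr_natl in Gc *; rewrite ltNge Gc.
Qed.

(** After expanding the square, the [s] diagonal terms are at most 1 for every permutation, and the
    others are at most 0 after summation over [t]. *)
Lemma sum_perm_block_le (T : finType) (s : nat) (io : 'I_s -> T) (f : T -> R) :
  injective io -> \sum_u f u = 0 -> (forall u, `|f u| <= 1) ->
  \sum_(t : {perm T}) (\sum_a f (t (io a))) ^+ 2 <= #|{perm T}|%:R * s%:R.
Proof.
move=> io_inj f0 f1.
have -> : \sum_(t : {perm T}) (\sum_a f (t (io a))) ^+ 2 =
    \sum_a \sum_a' \sum_(t : {perm T}) f (t (io a)) * f (t (io a')).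
  under eq_bigr => t _ do rewrite expr2 mulr_suml.
  rewrite exchange_big; apply: eq_bigr => a _.
  under eq_bigr => t _ do rewrite mulr_sumr.
  by rewrite exchange_big.
have -> : #|{perm T}|%:R * s%:R = \sum_(a < s) (#|{perm T}|%:R : R).
  by rewrite sumr_const card_ord mulr_natr.
apply: ler_sum => a _; rewrite (bigD1 a) //= -[leRHS]addr0; apply: lerD.
  rewrite -[X in _ <= X%:R]sum1_card natr_sum; apply: ler_sum => t _.
  by rewrite -expr2 -real_normK ?num_real // expr_le1.
apply: sumr_le0 => a' aa'; apply: sum_perm_pair_le0 => //.
by rewrite (inj_eq io_inj) eq_sym.
Qed.

Lemma exists_balanced_perm (T X : finType) (N s : nat) (io : 'I_N -> 'I_s -> T)
    (F : X -> T -> R) :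
  (forall j, injective (io j)) ->
  (forall v, \sum_u F v u = 0) -> (forall v u, `|F v u| <= 1) ->
  exists t : {perm T},
    \sum_v \sum_j (\sum_a F v (t (io j a))) ^+ 2 <= #|X|%:R * (N%:R * s%:R).
Proof.
move=> io_inj F0 F1; apply: exists_le_average.
  by apply/card_gt0P; exists 1%g.
rewrite exchange_big /=; apply: (@le_trans _ _ (\sum_(v : X) \sum_(j < N) #|{perm T}|%:R * s%:R)).
  apply: ler_sum => v _; rewrite exchange_big /=; apply: ler_sum => j _.
  exact: sum_perm_block_le.
move: (#|{perm T}|%:R : R) => p; rewrite !sumr_const card_ord.
by rewrite -[_ *+ #|X|]mulr_natl -[_ *+ N]mulr_natl [N%:R * _]mulrCA [X in X <= _]mulrCA.
Qed.

End RandomPermutation.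

(** * Ranks and monotone labelings *)

Lemma exists_rank (X : finType) (key : X -> nat) : injective key ->
  exists phi : X -> 'I_#|X|, bijective phi /\
    forall x y, (phi x < phi y)%N = (key x < key y)%N.
Proof.
move=> key_inj; pose S x := [set y | (key y < key x)%N].
have S_lt x : (#|S x| < #|X|)%N.
  rewrite -cardsT; apply: proper_card; rewrite properT.
  by apply/eqP => /setP/(_ x); rewrite !inE ltnn.
pose phi x := Ordinal (S_lt x).
have phi_lt x y : (key x < key y)%N -> (phi x < phi y)%N.
  move=> xy; apply: proper_card; apply/properP; split.
    by apply/subsetP => z; rewrite !inE => /ltn_trans; apply.
  by exists x; rewrite !inE ?ltnn.
have phiE x y : (phi x < phi y)%N = (key x < key y)%N.
  apply/idP/idP => [|/phi_lt //]; case: (ltngtP (key x) (key y)) => // [/phi_lt yx|/key_inj ->].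
    by rewrite ltnNge (ltnW yx).
  by rewrite ltnn.
exists phi; split=> //; apply: inj_card_bij; last by rewrite (card_ord #|X|).
by move=> x y xy; apply: key_inj; case: (ltngtP (key x) (key y)) => //; rewrite -phiE xy ltnn.
Qed.

(** The value lists of [f] and [g] are sorted and are permutations of each other. *)
Lemma monotone_fibers_eq (N k : nat) (f g : 'I_N -> 'I_k) :
  (forall p p', f p' < f p -> p' < p)%N -> (forall p p', g p' < g p -> p' < p)%N ->
  (forall i, #|[set p | f p == i]| = #|[set p | g p == i]|) -> f =1 g.
Proof.
have srt (f' : 'I_N -> 'I_k) : (forall p p', f' p' < f' p -> p' < p)%N ->
    sorted leq [seq val (f' p) | p <- enum 'I_N].
  move=> f'P; rewrite sorted_map.
  apply: (@sub_sorted _ (relpre val ltn)); last first.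
    by rewrite -sorted_map val_enum_ord iota_ltn_sorted.
  by move=> p p' /= pp'; rewrite leqNgt; apply/negP => /f'P; rewrite ltnNge (ltnW pp').
move=> fP gP fg.
have : [seq val (f p) | p <- enum 'I_N] = [seq val (g p) | p <- enum 'I_N].
  apply: (sorted_eq leq_trans anti_leq (srt f fP) (srt g gP)).
  rewrite 2!(map_comp val); apply: perm_map; apply/allP => i _ /=.
  have cE (f' : 'I_N -> 'I_k) :
      count (preim f' (pred1 i)) (enum 'I_N) = #|[set p | f' p == i]|.
    rewrite -sum1_count big_enum_cond -sum1_card; apply: eq_bigl => p.
    by rewrite !inE.
  by apply/eqP; rewrite [LHS]count_map [RHS]count_map !cE.
by move=> /eq_in_map E p; apply/val_inj/E; rewrite mem_enum.
Qed.

(** * Exactly tiled vertex sets and blow-ups of the bottlegraph *)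

Definition tileable (h n : nat) (H : ograph h) (G : ograph n) (D : {set 'I_n}) : Prop :=
  exists2 T, tiling H G T & covered T = D.

Section Tileable.
Variables (h n : nat) (H : ograph h) (G : ograph n).

Lemma tileable0 : tileable H G set0.
Proof.
exists set0; last by rewrite /covered big_set0.
by split=> f; rewrite inE.
Qed.

Lemma tileableU (D D' : {set 'I_n}) :
  [disjoint D & D'] -> tileable H G D -> tileable H G D' ->
  tileable H G (D :|: D').
Proof.
move=> DD' [T [Tc Td] TD] [T' [Tc' Td'] TD']; exists (T :|: T'); last first.
  by rewrite /covered bigcup_setU -TD -TD'.
have TT' f g : f \in T -> g \in T' -> [disjoint f @: setT & g @: setT].
  move=> fT gT; apply: disjointWl (disjointWr _ DD'); rewrite -?TD -?TD'.
    exact: bigcup_sup.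
  exact: bigcup_sup.
split=> [f|f g]; rewrite !inE; first by case/orP => [/Tc|/Tc'].
case/orP => fT /orP[] gT fg.
- exact: Td.
- exact: TT'.
- by rewrite disjoint_sym; apply: TT'.
- exact: Td'.
Qed.

Lemma tileable_embed (m : nat) (G' : ograph m) (e : 'I_m -> 'I_n) :
  (forall p p' : 'I_m, p < p' -> e p < e p')%N ->
  (forall p p', adj G' p p' -> adj G (e p) (e p')) ->
  has_perfect_tiling H G' -> tileable H G (e @: setT).
Proof.
move=> e_lt e_adj [T [Tc Td] Tcov].
have e_inj : injective e.
  by move=> p p' ee; apply/val_inj; case: (ltngtP p p') => // /e_lt; rewrite ee ltnn.
pose F (f : {ffun 'I_h -> 'I_m}) : {ffun 'I_h -> 'I_n} := [ffun i => e (f i)].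
have F_im f : F f @: setT = e @: (f @: setT).
  by rewrite -imset_comp; apply: eq_imset => i; rewrite ffunE.
exists (F @: T).
  split=> [_ /imsetP[f fT ->]|_ _ /imsetP[f fT ->] /imsetP[g gT ->] fg].
    have [f_lt f_adj] := Tc f fT; split=> i j ij; rewrite !ffunE.
      exact/e_lt/f_lt.
    exact/e_adj/f_adj.
  rewrite !F_im imset_disjoint //.
  by apply: Td => //; apply: contraNneq fg => ->.
rewrite /covered big_imset /=; last first.
  move=> f g _ _ /ffunP fg; apply/ffunP => i; apply: e_inj.
  by have := fg i; rewrite !ffunE.
rewrite -Tcov /covered; apply/setP => x; apply/bigcupP/imsetP.
  case=> f fT; rewrite F_im => /imsetP[p pf ->]; exists p => //.
  by apply/bigcupP; exists f.
case=> p /bigcupP[f fT pf] ->; exists f => //.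
by rewrite F_im imset_f.
Qed.

End Tileable.

(** The relation under which clusters of the right sizes span an ordered blow-up of a complete
    multipartite graph. *)
Definition joined (n : nat) (G : ograph n) (X Y : {set 'I_n}) : Prop :=
  {in X & Y, forall x y, adj G x y} /\
  ({in X & Y, forall x y : 'I_n, (x < y)%N} \/ {in X & Y, forall x y : 'I_n, (y < x)%N}).

Lemma joined_sub (n : nat) (G : ograph n) (X Y X' Y' : {set 'I_n}) :
  X' \subset X -> Y' \subset Y -> joined G X Y -> joined G X' Y'.
Proof.
move=> /subsetP XX /subsetP YY [XYa XYo]; split.
  by move=> x y /XX xX /YY; apply: XYa.
by case: XYo => XYo; [left|right] => x y /XX xX /YY; apply: XYo.
Qed.

Lemma joined_disjoint (n : nat) (G : ograph n) (X Y : {set 'I_n}) :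
  joined G X Y -> [disjoint X & Y].
Proof.
case=> XY _; rewrite disjoint_subset; apply/subsetP => x xX.
by rewrite inE; apply/negP => /(XY x x xX); rewrite adj_irrefl.
Qed.

Section Bottle.
Variables (h : nat) (H : ograph h) (V : finType) (B : sgraph V) (k : nat).
Variable (part : V -> 'I_k).
Hypothesis hB : complete_multipartite B part.
Let b i := #|[set x | part x == i]|.

Lemma part_size_gt0 i : (0 < b i)%N.
Proof. by have [x xi] := hB.1 i; apply/card_gt0P; exists x; rewrite inE xi. Qed.

Lemma sum_part_size : (\sum_i b i = #|V|)%N.
Proof.
rewrite -sum1_card (partition_big part predT) //=; apply: eq_bigr => i _.
by rewrite /b -sum1_card; apply: eq_bigl => x; rewrite inE.
Qed.

Lemma exists_interval_labeling (s : {perm 'I_k}) :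
  exists phi : V -> 'I_#|V|, interval_labeling part s phi.
Proof.
pose key x := (s (part x) * #|V| + enum_rank x)%N.
have key_lt x y : (s (part x) < s (part y))%N -> (key x < key y)%N.
  move=> xy; have := ltn_ord (enum_rank x); rewrite /key => hx.
  apply: (@leq_trans ((s (part x)).+1 * #|V|)); first by rewrite mulSn addnC ltn_add2r.
  by apply: leq_trans (leq_addr _ _); rewrite leq_mul2r xy orbT.
have key_inj : injective key.
  move=> x y xy; have := key_lt x y; have := key_lt y x; rewrite xy ltnn.
  case: (ltngtP (s (part x)) (s (part y))) => [_ _ /(_ isT)|_ /(_ isT)|e _ _] //.
  by move: xy; rewrite /key e => /addnI/val_inj/enum_rank_inj.
have [phi [phib phiP]] := exists_rank key_inj.
by exists phi; split=> // x y /key_lt; rewrite phiP.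
Qed.

(** Adjacency in the blow-up depends only on the parts, so it suffices that the increasing
    enumeration [e] of the union runs through the clusters as the positions of [G'] run through the
    parts. Both follow the order [s] with the same sizes, hence agree. *)
Lemma blowup_tileable (s : {perm 'I_k}) (phi : V -> 'I_#|V|) (t : nat)
    (G' : ograph (#|V| * t)) (n : nat) (G : ograph n) (C : 'I_k -> {set 'I_n}) :
  interval_labeling part s phi -> is_ordered_blowup B phi G' ->
  has_perfect_tiling H G' ->
  (forall i, #|C i| = (t * b i)%N) ->
  (forall i j, i != j -> {in C i & C j, forall x y, adj G x y}) ->
  (forall i j, (s i < s j)%N -> {in C i & C j, forall x y : 'I_n, (x < y)%N}) ->
  tileable H G (\bigcup_i C i).
Proof.
move=> [phib phis] [pos [posb pos_lt pos_adj]] G'H Cb Cadj Clt.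
pose D := \bigcup_i C i.
have Cdisj i j x : x \in C i -> x \in C j -> i = j.
  move=> xi xj; apply/eqP/contraT => ij.
  by have := Cadj i j ij x x xi xj; rewrite adj_irrefl.
have cardD : #|D| = (#|V| * t)%N.
  transitivity (\sum_i #|C i|)%N; last first.
    by under eq_bigr do rewrite Cb; rewrite -big_distrr /= sum_part_size mulnC.
  rewrite -sum1_card partition_disjoint_bigcup /=.
    by apply: eq_bigr => i _; rewrite sum1_card.
  move=> i j ij.
  rewrite -setI_eq0; apply/eqP/setP => x; rewrite !inE.
  by apply/negP => /andP[xi xj]; rewrite (Cdisj _ _ _ xi xj) eqxx in ij.
have [rk [rkb rkP]] := @exists_rank {x | x \in D} (fun x => val (val x)) (inj_comp val_inj val_inj).
have cD : #|{: {x | x \in D}}| = (#|V| * t)%N by rewrite card_sig -cardD; apply: eq_card.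
have [inv invK Kinv] := rkb.
pose e p := val (inv (cast_ord (esym cD) p)).
have e_lt (p p' : 'I_(#|V| * t)) : (p < p')%N = (e p < e p')%N.
  by rewrite /e -rkP !Kinv.
have eD p : e p \in D by apply: valP.
have e_im : e @: setT = D.
  apply/setP => x; apply/imsetP/idP => [[p _ ->] //|xD].
  exists (cast_ord cD (rk (Sub x xD))) => //.
  by rewrite /e cast_ordK invK SubK.
have [pinv posK Kpos] := posb.
have cl p : exists i, e p \in C i by have /bigcupP[i _ ei] := eD p; exists i.
have [c cP] := fin_all_exists cl.
(* [f p] is the rank of the part at position [p] of the blow-up, [g p] that of the cluster
   containing the [p]-th vertex of the union. *)
pose f p := s (part (pinv p).1).
pose g p := s (c p).
have fg : f =1 g.
  apply: monotone_fibers_eq.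
  - move=> p p' ff; rewrite -(Kpos p) -(Kpos p').
    by apply/pos_lt/phis.
  - by move=> p p' gg; rewrite e_lt; apply: Clt gg _ _ _ _.
  move=> j.
  have -> : #|[set p | f p == j]| = (t * b ((s^-1)%g j))%N.
    rewrite -(card_imset _ (can_inj Kpos)).
    have -> : pinv @: [set p | f p == j] =
        setX [set x | part x == (s^-1)%g j] [set: 'I_t].
      apply/setP => u; rewrite !inE andbT.
      apply/imsetP/eqP => [[p + ->]|uj].
        by rewrite inE => /eqP <-; rewrite permK.
      by exists (pos u); rewrite ?inE ?posK // /f posK uj permKV.
    by rewrite cardsX cardsT card_ord mulnC.
  have e_inj : injective e.
    by move=> p p' pp'; apply/val_inj; case: (ltngtP p p') => //; rewrite e_lt pp' ltnn.
  rewrite -Cb; transitivity #|e @: [set p | g p == j]|; last exact: card_imset.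
  congr #|pred_of_set _|; apply/setP => x; apply/idP/imsetP.
    move=> xj; have : x \in D by apply/bigcupP; exists ((s^-1)%g j).
    rewrite -e_im => /imsetP[p _ xp]; exists p => //.
    have cj := cP p; rewrite -xp in cj.
    by rewrite inE /g (Cdisj _ _ _ cj xj) permKV.
  by case=> p + ->; rewrite inE => /eqP <-; rewrite permK.
rewrite -/D -e_im; apply: tileable_embed G'H; first by move=> p p'; rewrite e_lt.
move=> p p'; rewrite -(Kpos p) -(Kpos p') pos_adj /= /blowup_adj hB.2 !Kpos => pp'.
apply: Cadj (cP p) (cP p'); apply: contra pp' => /eqP cc.
by have := fg p; rewrite /f /g cc -[s (c p')]fg => /perm_inj ->.
Qed.

Lemma copies_tileable (s : {perm 'I_k}) (phi : V -> 'I_#|V|) (t c : nat)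
    (G' : ograph (#|V| * t)) (n : nat) (G : ograph n) (C : 'I_k -> {set 'I_n}) :
  interval_labeling part s phi -> is_ordered_blowup B phi G' ->
  has_perfect_tiling H G' ->
  (forall i, #|C i| = (c * t * b i)%N) ->
  (forall i j, i != j -> {in C i & C j, forall x y, adj G x y}) ->
  (forall i j, (s i < s j)%N -> {in C i & C j, forall x y : 'I_n, (x < y)%N}) ->
  tileable H G (\bigcup_i C i).
Proof.
move=> phis G'B G'H; elim: c C => [|c IHc] C Cb Cadj Clt.
  rewrite big1; first exact: tileable0.
  by move=> i _; apply/eqP; rewrite -cards_eq0 Cb.
have sub i : exists X : {set 'I_n}, X \subset C i /\ #|X| = (t * b i)%N.
  have [|X XC Xb] := @exists_subset_card _ (C i) (t * b i).
    by rewrite Cb mulSn mulnDl leq_addr.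
  by exists X.
have [X XP] := fin_all_exists sub.
have XC i : {subset X i <= C i} by apply/subsetP; have [] := XP i.
have CX i : {subset C i :\: X i <= C i} by move=> x; rewrite inE => /andP[].
have -> : \bigcup_i C i = \bigcup_i X i :|: \bigcup_i (C i :\: X i).
  rewrite -big_split /=; apply: eq_bigr => i _.
  by rewrite -[LHS](setID _ (X i)) (setIidPr _) //; have [] := XP i.
apply: tileableU.
- rewrite disjoint_subset; apply/subsetP => x /bigcupP[i _ xi].
  rewrite inE; apply/bigcupP => -[j _]; rewrite inE => /andP[xj xCj].
  have [ij|ij] := eqVneq i j; first by rewrite -ij xi in xj.
  by have := Cadj i j ij x x (XC _ _ xi) xCj; rewrite adj_irrefl.
- apply: blowup_tileable phis G'B G'H _ _ _; first by move=> i; have [] := XP i.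
    by move=> i j ij x y /XC xi /XC; apply: Cadj ij _ _ xi.
  by move=> i j ij x y /XC xi /XC; apply: Clt ij _ _ xi.
apply: IHc.
- move=> i; rewrite cardsD (setIidPr _); last by have [] := XP i.
  by rewrite Cb (XP i).2 mulSn mulnDl addKn.
- by move=> i j ij x y /CX xi /CX; apply: Cadj ij _ _ xi.
by move=> i j ij x y /CX xi /CX; apply: Clt ij _ _ xi.
Qed.

(** A common multiple [L] of the constants [t s] over all permutations [s] serves every order in
    which the clusters may lie. *)
Lemma bottlegraph_tileable : bottlegraph H B part ->
  exists L, (0 < L)%N /\ forall n (G : ograph n) (C : 'I_k -> {set 'I_n}),
    (forall i, #|C i| = (L * b i)%N) ->
    (forall i j, i != j -> joined G (C i) (C j)) ->
    tileable H G (\bigcup_i C i).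
Proof.
move=> hHB.
have tex s : exists t, (0 < t)%N /\ exists phi (G' : ograph (#|V| * t)),
    [/\ interval_labeling part s phi, is_ordered_blowup B phi G' & has_perfect_tiling H G'].
  have [phi phis] := exists_interval_labeling s.
  have [t [t0 [G' G'B G'H]]] := hHB s phi phis.
  by exists t; split=> //; exists phi, G'.
have [t tP] := fin_all_exists tex.
pose L := (\prod_s t s)%N.
have L0 : (0 < L)%N by apply: prodn_gt0 => s; have [] := tP s.
exists L; split=> // n G C Cb Cj.
have Cne i : exists x, x \in C i by apply/card_gt0P; rewrite Cb muln_gt0 L0 part_size_gt0.
have [x xC] := fin_all_exists Cne.
(* Pairwise joined clusters are linearly ordered, so the ranks of one representative each define the
   permutation [s]. *)
have x_inj : injective (fun i => val (x i)).
  move=> i j /val_inj xx; apply/eqP/contraT => /Cj[/(_ (x i) (x j) (xC i) (xC j))].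
  by rewrite xx adj_irrefl.
have [rk [rkb rkP]] := exists_rank x_inj.
have s_inj : injective (fun i => cast_ord (card_ord k) (rk i)).
  by move=> i j /cast_ord_inj; apply: bij_inj.
pose s := perm s_inj.
have [_ [phi [G' [phis G'B G'H]]]] := tP s.
apply: (copies_tileable (c := L %/ t s) phis G'B G'H).
- by move=> i; rewrite Cb divnK // /L (bigD1 s) //= dvdn_mulr.
- by move=> i j /Cj[].
move=> i j; rewrite !permE /= rkP => ij u v ui vj.
have /Cj[_ [lt|gt]] : i != j by apply: contraTneq ij => ->; rewrite ltnn.
  exact: lt.
by have := gt _ _ (xC i) (xC j); rewrite ltnNge (ltnW ij).
Qed.

(** The tiles are realised one at a time, each taking [L * b i] vertices from the cluster [tau i];
    the load hypothesis passes to the remaining tiles and the reduced clusters. *)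
Lemma packing_tileable (L : nat) (n : nat) (G : ograph n) (W : finType) (E : rel W)
    (ts : seq {ffun 'I_k -> W}) (A : W -> {set 'I_n}) :
  (forall C : 'I_k -> {set 'I_n}, (forall i, #|C i| = (L * b i)%N) ->
    (forall i j, i != j -> joined G (C i) (C j)) ->
    tileable H G (\bigcup_i C i)) ->
  irreflexive E ->
  {in ts, forall tau : {ffun 'I_k -> W}, forall i j, i != j -> E (tau i) (tau j)} ->
  (forall w w', E w w' -> joined G (A w) (A w')) ->
  (forall w w', w != w' -> [disjoint A w & A w']) ->
  (forall w, (L * tile_load b ts w <= #|A w|)%N) ->
  exists D, [/\ tileable H G D, D \subset \bigcup_w A w &
    #|D| = (L * #|V| * size ts)%N].
Proof.
move=> LC Eirr; elim: ts A => [|tau ts IHts] A tsE AE Ad Al.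
  by exists set0; rewrite cards0 muln0 sub0set; split=> //; apply: tileable0.
have tauE : forall i j, i != j -> E (tau i) (tau j) by apply: tsE; rewrite mem_head.
have tau_inj : injective tau.
  by move=> i j tt; apply/eqP/contraT => /tauE; rewrite tt Eirr.
have sub i : exists X : {set 'I_n}, X \subset A (tau i) /\ #|X| = (L * b i)%N.
  have [|X XC Xb] := @exists_subset_card _ (A (tau i)) (L * b i); last by exists X.
  apply: leq_trans (Al _); rewrite leq_mul2l tile_load_cons (bigD1 i) //= eqxx muln1.
  by rewrite -addnA leq_addr orbT.
have [X XP] := fin_all_exists sub.
have XA i : X i \subset A (tau i) by have [] := XP i.
have Xj i j : i != j -> joined G (X i) (X j).
  by move=> ij; apply: joined_sub (XA i) (XA j) _; apply/AE/tauE.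
pose U := \bigcup_i X i.
have AU w w' : A w :\: U \subset A w by apply: subsetDl.
have [||w w' ww'|w|D [Dt DA Dc]] := IHts (fun w => A w :\: U).
- by move=> t tin; apply: tsE; rewrite inE tin orbT.
- by move=> w w' /AE; apply: joined_sub; apply: subsetDl.
- by apply: disjointWl (subsetDl _ _) (disjointWr (subsetDl _ _) (Ad _ _ ww')).
- have := Al w; rewrite tile_load_cons mulnDr => Alw.
  have UA : (#|A w :&: U| <= L * \sum_i b i * (tau i == w))%N.
    case: (pickP (fun i => tau i == w)) => [i /eqP iw|none].
      rewrite (bigD1 i) //= iw eqxx muln1 mulnDr; apply: leq_trans (leq_addr _ _).
      rewrite -(XP i).2; apply/subset_leq_card/subsetP => x.
      rewrite inE => /andP[xw /bigcupP[j _ xj]]; suff <- : j = i by [].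
      apply: tau_inj; apply/eqP/contraT => /Ad; rewrite iw => /disjointFr/(_ (subsetP (XA j) _ xj)).
      by rewrite xw.
    rewrite (_ : A w :&: U = set0) ?cards0 //; apply/setP => x; rewrite !inE.
    apply/negP => /andP[xw /bigcupP[j _ xj]].
    have /Ad/disjointFr/(_ (subsetP (XA j) _ xj)) : tau j != w by rewrite none.
    by rewrite xw.
  by have := cardsID U (A w); lia.
have DU : [disjoint U & D].
  rewrite disjoint_sym; apply: disjointWl DA _.
  rewrite disjoint_subset; apply/subsetP => x /bigcupP[w _].
  by rewrite !inE => /andP[].
exists (U :|: D); split.
- by apply: tileableU => //; apply: LC => // i; have [] := XP i.
- rewrite subUset; apply/andP; split.
    apply/bigcupsP => i _; apply: subset_trans (XA i) _; exact: bigcup_sup.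
  apply: subset_trans DA _; apply/bigcupsP => w _; apply: subset_trans (subsetDl _ _) _.
  exact: bigcup_sup.
rewrite cardsU (disjoint_setI0 DU) cards0 subn0 Dc /= mulnS; congr addn.
rewrite -sum_part_size big_distrr /= -(eq_bigr _ (fun i _ => (XP i).2)).
rewrite -sum1_card partition_disjoint_bigcup => [|i j /Xj/joined_disjoint //].
by apply: eq_bigr => i _; rewrite sum1_card.
Qed.

End Bottle.

(** * From homogeneous families of blocks to tilings *)

Section BlockTiling.
Variables (h : nat) (H : ograph h) (V : finType) (B : sgraph V) (r : nat).
Variable (part : V -> 'I_r.+2).
Hypothesis hB : complete_multipartite B part.
Let b i := #|[set x | part x == i]|.
Variables (n : nat) (G : ograph n) (L : nat) (i0 : 'I_r.+2).
Hypothesis hL : forall C : 'I_r.+2 -> {set 'I_n}, (forall i, #|C i| = (L * b i)%N) ->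
    (forall i j, i != j -> joined G (C i) (C j)) ->
    tileable H G (\bigcup_i C i).

(** The size [m] is [L] times the largest load allowed by [balanced_tiles], so all tiles fit, and
    the mean load is the fraction [g / g.+1] of that maximum. *)
Lemma cluster_tiling (W : finType) (E : rel W) (A : W -> {set 'I_n}) (a Q g m : nat) :
  symmetric E -> irreflexive E -> (0 < #|W| <= Q)%N ->
  (forall w, #|[set u | ~~ E w u]| <= a)%N ->
  (r.+1 * a * #|V| <= (#|V| - b i0) * #|W|)%N ->
  (forall w w', E w w' -> joined G (A w) (A w')) ->
  (forall w w', w != w' -> [disjoint A w & A w']) ->
  m = (L * (#|V| * Q * g * g.+1))%N -> (forall w, #|A w| = m) ->
  exists D, [/\ tileable H G D, D \subset \bigcup_w A w &
    (#|D| * g.+1 = #|W| * m * g)%N].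
Proof.
move=> Esym Eirr WQ Ea Wa AE Ad mE Am.
rewrite -(sum_part_size part) in Wa mE.
have [ts [tsT tsE tsl]] := balanced_tiles g Esym (part_size_gt0 hB i0) WQ Ea Wa.
have [|D [Dt DA Dc]] := packing_tileable hL Eirr tsE AE Ad.
  by move=> w; rewrite Am mE leq_mul2l tsl orbT.
exists D; split=> //; rewrite Dc tsT mE -(sum_part_size part) -mulnn.
by move: (\sum_i _)%N => S; ring.
Qed.

Variables (N s K theta : nat) (x : 'I_N -> 'I_s -> 'I_n).
Hypothesis x_inj : forall j j' a a', x j a = x j' a' -> j = j' /\ a = a'.

Definition overfull (v : 'I_n) (j : 'I_N) : bool :=
  (theta < #|[set a | ~~ adj G v (x j a)]|)%N.

(* The diagonal is included so that families of blocks which are pairwise not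
   bad are disjoint. *)
Definition bad_pair (j j' : 'I_N) : bool :=
  (j == j') || (s < #|[set a | overfull (x j a) j']| * K ^ 2)%N.

Definition pair_type (j j' : 'I_N) : {ffun 'I_s * 'I_s -> bool * bool} :=
  [ffun u => (adj G (x j u.1) (x j' u.2), (x j u.1 < x j' u.2)%N)].

Definition block (j : 'I_N) : {set 'I_n} := x j @: setT.

(** The pair [(p, a)] stands for the cluster of the [a]-th vertices of the blocks in [A p]. By
    homogeneity one block [c p] per family determines the reduced graph, to which [cluster_tiling]
    is applied after discarding the few clusters of low degree. *)
Lemma homogeneous_blocks_tiling (A : 'I_K -> {set 'I_N})
    (gam : 'I_K -> 'I_K -> {ffun 'I_s * 'I_s -> bool * bool}) (m : nat) :
  (1 < K)%N -> (0 < s)%N -> (0 < m)%N ->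
  m = (L * (#|V| * (K * s) * K * K.+1))%N ->
  (r.+1 * (2 * s + K * theta) * #|V| <= (#|V| - b i0) * (K.-1 * s))%N ->
  (forall p, #|A p| = m) ->
  (forall p p', p != p' -> {in A p & A p', forall j j',
     ~~ bad_pair j j' /\ pair_type j j' = gam p p'}) ->
  exists D, [/\ tileable H G D, D \subset \bigcup_(j in \bigcup_p A p) block j &
    (K.-1 * (K * s * m) <= #|D| * K.+1)%N].
Proof.
move=> K1 s0 m0 mE cond Am AP.
have Ane p : exists j, j \in A p by apply/card_gt0P; rewrite Am.
have [c cA] := fin_all_exists Ane.
have Adis p p' j : j \in A p -> j \in A p' -> p = p'.
  move=> jp jp'; apply/eqP/contraT => pp'.
  by have [] := AP p p' pp' j j jp jp'; rewrite /bad_pair eqxx.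
pose E (w w' : 'I_K * 'I_s) := (w.1 != w'.1) && adj G (x (c w.1) w.2) (x (c w'.1) w'.2).
pose exc (w : 'I_K * 'I_s) :=
  #|[set p' | (w.1 != p') && overfull (x (c w.1) w.2) (c p')]|.
(* Each of the at most [K ^ 2] pairs of distinct families contributes at most [s / K ^ 2], as its
   representative blocks are not bad. *)
have exc_sum : (\sum_w exc w <= s)%N.
  have -> : (\sum_w exc w =
      \sum_p \sum_(p' | p != p') #|[set a | overfull (x (c p) a) (c p')]|)%N.
    rewrite -(pair_bigA _ (fun p a => exc (p, a))) /=; apply: eq_bigr => p _.
    rewrite (eq_bigr (fun a => \sum_(p' | (p != p') && overfull (x (c p) a) (c p')) 1)%N).
      rewrite (exchange_big_dep (fun p' => p != p')) /=; last by move=> a p' _ /andP[].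
      by apply: eq_bigr => p' pp'; rewrite sum1dep_card; apply: eq_card => a; rewrite !inE pp'.
    by move=> a _; rewrite sum1dep_card.
  have K2 : (0 < K ^ 2)%N by rewrite expn_gt0 (ltnW K1).
  rewrite -(leq_pmul2r K2) big_distrl /=.
  apply: (@leq_trans (\sum_(p < K) \sum_(p' < K) s)); last first.
    by rewrite !sum_nat_const card_ord -mulnn mulnA mulnC.
  apply: leq_sum => p _; rewrite big_distrl big_mkcond /=; apply: leq_sum => p' _.
  have [//|pp'] := eqVneq p p'.
  have [+ _] := AP p p' pp' _ _ (cA p) (cA p').
  by rewrite /bad_pair negb_or -leqNgt => /andP[].
(* All but [s] of the [K * s] clusters miss the degree condition towards at most
   one family. *)
pose W := {w : 'I_K * 'I_s | (exc w <= 1)%N}.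
have Wge : (K.-1 * s <= #|{: W}|)%N.
  have eW : #|{: W}| = #|[set w | (exc w <= 1)%N]|.
    by rewrite card_sig; apply: eq_card => w; rewrite !inE.
  have le : (#|~: [set w | (exc w <= 1)%N]| <= s)%N.
    apply: leq_trans exc_sum; rewrite -sum1_card.
    rewrite [leqRHS](bigID (mem (~: [set w | (exc w <= 1)%N]))) /=.
    apply: leq_trans (leq_addr _ _); apply: leq_sum => w.
    by rewrite !inE -ltnNge; apply: leq_trans.
  have := cardsC [set w | (exc w <= 1)%N].
  rewrite -eW card_prod !card_ord -subn1 mulnBl mul1n => <-.
  by rewrite leq_subLR addnC leq_add2r.
pose EW : rel W := fun w w' => E (val w) (val w').
pose AW (w : W) := [set x j (val w).2 | j in A (val w).1].
have [|||||||||D [Dt DA Dc]] := @cluster_tiling W EW AW (2 * s + K * theta) (K * s) K m.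
- by move=> w w'; rewrite /EW /E eq_sym adj_sym.
- by move=> w; rewrite /EW /E eqxx.
- rewrite (leq_trans _ Wge) ?muln_gt0 ?s0 ?andbT /=; last by rewrite -ltnS prednK // ltnW.
  by rewrite card_sig -[K in (K * s)%N]card_ord -[s in leqRHS]card_ord -card_prod max_card.
- case=> -[p a] pa1; rewrite -(card_imset _ val_inj) /EW /=.
  apply: (@leq_trans (\sum_p' #|[set a' | ~~ E (p, a) (p', a')]|)).
    rewrite -sum1_card (partition_big (fun u : 'I_K * 'I_s => u.1) predT) //=.
    apply: leq_sum => p' _; rewrite sum1_card.
    have inj2 : injective (fun u : 'I_s => (p', u)) by move=> u u' [].
    rewrite -(card_imset _ inj2); apply/subset_leq_card/subsetP => -[p2 a2].
    rewrite unfold_in /= => /andP[/imsetP[u + uE] /eqP p2E].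
    rewrite inE -uE p2E => nE; apply: imset_f; by rewrite inE.
  (* A kept cluster has at most [s] non-neighbours in its own family, [s] in the one family that may
     be overfull, and [theta] in each other family. *)
  rewrite (bigD1 p) //= mul2n -addnn -addnA; apply: leq_add.
    by apply: leq_trans (max_card _) _; rewrite card_ord.
  rewrite (bigID (fun p' => overfull (x (c p) a) (c p'))) /=; apply: leq_add.
    apply: (@leq_trans (\sum_(p' | (p' != p) && overfull (x (c p) a) (c p')) s)).
      by apply: leq_sum => p' _; apply: leq_trans (max_card _) _; rewrite card_ord.
    rewrite sum_nat_const -[leqRHS]mul1n leq_mul2r; apply/orP; right.
    apply: leq_trans pa1; apply/subset_leq_card/subsetP => p'.
    by rewrite unfold_in /= !inE eq_sym.
  apply: (@leq_trans (\sum_(p' | (p' != p) && ~~ overfull (x (c p) a) (c p')) theta)).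
    apply: leq_sum => p' /andP[pp']; rewrite -leqNgt; apply: leq_trans.
    by apply/subset_leq_card/subsetP => a'; rewrite !inE /E /= eq_sym pp'.
  by rewrite sum_nat_const; apply: leq_mul => //; rewrite -[leqRHS]card_ord max_card.
- by apply: leq_trans cond _; rewrite leq_mul2l Wge orbT.
- move=> [[p a] wp] [[p' a'] wp'] /= /andP[/= pp' ad]; rewrite /AW /=.
  have ty j j' : j \in A p -> j' \in A p' ->
      (adj G (x j a) (x j' a'), (x j a < x j' a')%N) =
      (adj G (x (c p) a) (x (c p') a'), (x (c p) a < x (c p') a')%N).
    move=> jp jp'; have [_ t1] := AP _ _ pp' _ _ jp jp'.
    have [_ t2] := AP _ _ pp' _ _ (cA p) (cA p').
    by have := congr1 (fun f : {ffun _} => f (a, a')) (etrans t1 (esym t2)); rewrite !ffunE.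
  have tad : {in [set x j a | j in A p] & [set x j a' | j in A p'],
      forall v v', adj G v v'}.
    by move=> _ _ /imsetP[j jp ->] /imsetP[j' jp' ->]; have [-> _] := ty j j' jp jp'.
  split=> //; case lt : (x (c p) a < x (c p') a')%N; [left|right].
    by move=> _ _ /imsetP[j jp ->] /imsetP[j' jp' ->]; have [_ ->] := ty j j' jp jp'.
  move=> v v' vp vp'; have := tad v v' vp vp'.
  case/imsetP: vp => j jp ->; case/imsetP: vp' => j' jp' ->.
  have [_ xx] := ty j j' jp jp'; rewrite lt in xx.
  case: (ltngtP (x j' a') (x j a)) => // [xlt|/val_inj ->]; last by rewrite adj_irrefl.
  by rewrite xlt in xx.
- move=> [[p a] wp] [[p' a'] wp']; rewrite /AW /= => ww'.
  rewrite disjoint_subset; apply/subsetP => _ /imsetP[j jp ->].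
  rewrite inE; apply/imsetP => -[j' jp'] /x_inj[jj aa].
  rewrite -jj in jp'; case/eqP: ww'; apply/val_inj => /=.
  by rewrite aa (Adis _ _ _ jp jp').
- by [].
- move=> [[p a] wp]; rewrite /AW /= card_imset ?Am //.
  by move=> j j' /x_inj[].
exists D; split=> //.
  apply: subset_trans DA _; apply/bigcupsP => -[[p a] wp] _.
  apply/subsetP => _ /imsetP[j /= jp ->]; apply/bigcupP; exists j.
    by apply/bigcupP; exists p.
  by apply: imset_f.
have -> : (K.-1 * (K * s * m) = K.-1 * s * (m * K))%N by ring.
by rewrite Dc -[leqRHS]mulnA leq_mul2r Wge orbT.
Qed.

(** Families are removed while more than [z] blocks remain; the bound on bad pairs is stated for
    [z], so [box] keeps applying. Each family is covered in the proportion [K.-1 / K.+1], and the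
    last blocks, at most [z], are given up. *)
Lemma greedy_blocks_tiling (m N0 z : nat) :
  (1 < K)%N -> (0 < s)%N -> (0 < m)%N ->
  m = (L * (#|V| * (K * s) * K * K.+1))%N ->
  (r.+1 * (2 * s + K * theta) * #|V| <= (#|V| - b i0) * (K.-1 * s))%N ->
  (forall (T : finType) (bad : rel T) (col : T -> T -> {ffun 'I_s * 'I_s -> bool * bool}),
    (N0 <= #|T|)%N ->
    (2 * K ^ 2 * #|[set u : T * T | bad u.1 u.2]| <= #|T| ^ 2)%N ->
    exists (A : 'I_K -> {set T}) (gam : 'I_K -> 'I_K -> {ffun 'I_s * 'I_s -> bool * bool}),
      (forall p, #|A p| = m) /\
      forall p p', p != p' -> {in A p & A p', forall i j, ~~ bad i j /\ col i j = gam p p'}) ->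
  (N0 <= z)%N ->
  (2 * K ^ 2 * #|[set u : 'I_N * 'I_N | bad_pair u.1 u.2]| <= z ^ 2)%N ->
  exists D, tileable H G D /\ (K.-1 * s * N <= #|D| * K.+1 + K.-1 * s * z)%N.
Proof.
move=> K1 s0 m0 mE cond box N0z badz.
suff main d (J : {set 'I_N}) : (#|J| < d)%N ->
    exists D, [/\ tileable H G D, D \subset \bigcup_(j in J) block j &
      (K.-1 * s * #|J| <= #|D| * K.+1 + K.-1 * s * z)%N].
  by have [D [Dt _]] := main _ setT (ltnSn _); rewrite cardsT card_ord => Dc; exists D.
elim: d J => // d IHd J Jd.
have [Jz|zJ] := leqP #|J| z.
  exists set0; split; [exact: tileable0 | exact: sub0set |].
  by rewrite cards0 mul0n leq_mul2l Jz orbT.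
pose T := {j : 'I_N | j \in J}.
have cT : #|{: T}| = #|J| by rewrite card_sig; apply: eq_card.
have [||A' [gam [Am' AP']]] := box T (relpre val bad_pair)
    (fun u v => pair_type (val u) (val v)).
- by rewrite cT (leq_trans N0z) // ltnW.
- rewrite cT; apply: (@leq_trans (z ^ 2)); last by rewrite leq_sqr ltnW.
  apply: leq_trans badz; rewrite leq_mul2l; apply/orP; right.
  have inj2 : injective (fun u : T * T => (val u.1, val u.2)).
    by move=> [u v] [u' v'] [] /val_inj -> /val_inj ->.
  rewrite -(card_imset _ inj2); apply/subset_leq_card/subsetP => _ /imsetP[u + ->].
  by rewrite !inE.
pose A p := val @: A' p.
have Am p : #|A p| = m by rewrite card_imset //; apply: val_inj.
have AP p p' : p != p' -> {in A p & A p', forall j j',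
    ~~ bad_pair j j' /\ pair_type j j' = gam p p'}.
  by move=> pp' _ _ /imsetP[u ui ->] /imsetP[v vi ->]; apply: AP'.
have [D [Dt DA Dc]] := homogeneous_blocks_tiling K1 s0 m0 mE cond Am AP.
pose U := \bigcup_p A p.
have UJ : U \subset J.
  by apply/bigcupsP => p _; apply/subsetP => _ /imsetP[u _ ->]; apply: valP.
have Adis p p' : p != p' -> [disjoint A p & A p'].
  move=> pp'; rewrite disjoint_subset; apply/subsetP => j jp.
  rewrite inE; apply/negP => jp'.
  by have [] := AP p p' pp' j j jp jp'; rewrite /bad_pair eqxx.
have Uc : #|U| = (K * m)%N.
  rewrite -sum1_card partition_disjoint_bigcup //=.
  under eq_bigr do rewrite sum1_card Am.
  by rewrite sum_nat_const card_ord.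
have Uc0 : (0 < #|U|)%N by rewrite Uc muln_gt0 m0 (ltnW K1).
have JU : (#|J| = #|J :\: U| + #|U|)%N by rewrite -(cardsID U J) (setIidPr UJ) addnC.
have [|D' [Dt' DJ' Dc']] := IHd (J :\: U).
  by rewrite JU in Jd; lia.
have DD' : [disjoint D & D'].
  apply: disjointWl DA _; rewrite disjoint_sym; apply: disjointWl DJ' _.
  rewrite disjoint_subset; apply/subsetP => v /bigcupP[j jJ /imsetP[a _ ->]].
  rewrite inE; apply/bigcupP => -[j' jU /imsetP[a' _ /x_inj[jj _]]].
  by rewrite inE jj jU in jJ.
exists (D :|: D'); split; first exact: tileableU.
  rewrite subUset; apply/andP; split.
    apply: subset_trans DA _; apply/bigcupsP => j jU.
    by apply: (bigcup_sup j); apply: (subsetP UJ).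
  apply: subset_trans DJ' _; apply/bigcupsP => j; rewrite inE => /andP[_ jJ].
  exact: (bigcup_sup j).
rewrite cardsU (disjoint_setI0 DD') cards0 subn0 JU Uc mulnDr mulnDl.
have -> : (K.-1 * s * (K * m) = K.-1 * (K * s * m))%N by ring.
by rewrite addnC -addnA; apply: leq_add.
Qed.

End BlockTiling.

(** * Critical chromatic number of a complete multipartite graph *)

Lemma bigminn_le (I : eqType) (r : seq I) (d : nat) (F : I -> nat) (i : I) :
  i \in r -> (\big[minn/d]_(j <- r) F j <= F i)%N.
Proof.
elim: r => // j r IHr; rewrite inE big_cons => /predU1P[->|/IHr].
  exact: geq_minl.
exact/leq_trans/geq_minr.
Qed.

Lemma le_bigminn (I : Type) (r : seq I) (P : pred I) (d c : nat) (F : I -> nat) :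
  (c <= d)%N -> (forall i, P i -> c <= F i)%N ->
  (c <= \big[minn/d]_(j <- r | P j) F j)%N.
Proof. by move=> cd cF; elim/big_ind: _ => // x y cx cy; rewrite leq_min cx. Qed.

Section CriticalChromaticNumber.
Variables (V : finType) (B : sgraph V) (k : nat) (part : V -> 'I_k).
Hypothesis hB : complete_multipartite B part.

Lemma complete_multipartite_rep : exists x : 'I_k -> V,
  (forall i, part (x i) = i) /\ forall (K : eqType) (c : V -> K),
    (forall u v, adj B u v -> c u != c v) -> injective (fun i => c (x i)).
Proof.
have [x xP] := fin_all_exists hB.1; exists x; split=> // K c cP i j cc.
apply/eqP/contraT => ij.
have : adj B (x i) (x j) by rewrite hB.2 !xP.
by move/cP; rewrite cc eqxx.
Qed.

Lemma proper_coloring_neq (q : nat) (c : {ffun V -> 'I_q}) :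
  proper_coloring B c -> forall u v, adj B u v -> c u != c v.
Proof. by move=> /forallP cP u v; have /forallP/(_ v)/implyP := cP u. Qed.

Lemma chi_complete_multipartite : chi B = k.
Proof.
rewrite /chi; case: ex_minnP => q /existsP[c /proper_coloring_neq cP] qmin.
have [x [_ xinj]] := complete_multipartite_rep.
apply/eqP; rewrite eqn_leq; apply/andP; split.
  apply: qmin; apply/existsP; exists [ffun v => part v].
  by apply/forallP => u; apply/forallP => v; apply/implyP; rewrite !ffunE hB.2.
by have := leq_card _ (xinj _ _ cP); rewrite !card_ord.
Qed.

(** Every colour class contains a whole part: with [chi B = k] colours each colour occurs at exactly
    one representative, and a vertex of its part is adjacent to the representatives carrying all
    other colours. *)
Lemma sigma_complete_multipartite_ge (d : nat) :
  (forall i, d <= #|[set x | part x == i]|)%N -> (0 < k)%N -> (d <= sigma B)%N.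
Proof.
move=> dle k0; have dV : (d <= #|V|)%N.
  by apply: leq_trans (dle (Ordinal k0)) (max_card _).
apply: le_bigminn => // c /proper_coloring_neq cP; apply: le_bigminn => // i _.
have [x [xpart xinj]] := complete_multipartite_rep.
have [g _ gK] : bijective (fun j => c (x j)).
  by apply: inj_card_bij (xinj _ _ cP) _; rewrite !card_ord chi_complete_multipartite.
apply: leq_trans (dle (g i)) _; apply/subset_leq_card/subsetP => v.
rewrite !inE => /eqP vi; rewrite -(inj_eq (can_inj gK)) -vi.
apply: contraT => gv; have : adj B v (x (g (c v))) by rewrite hB.2 xpart eq_sym.
by move/cP; rewrite gK eqxx.
Qed.

(** The inverse is [(#|V| - sigma B) / (k.-1 * #|V|)], which decreases in [sigma B]. *)
Lemma inv_chi_cr_le (R : realType) (i0 : 'I_k) :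
  (forall i, #|[set x | part x == i0]| <= #|[set x | part x == i]|)%N ->
  1 / chi_cr R B <= (#|V|%:R - #|[set x | part x == i0]|%:R) / (k.-1%:R * #|V|%:R).
Proof.
move=> i0P; have k0 : (0 < k)%N by apply: leq_ltn_trans (ltn_ord i0).
have sg := sigma_complete_multipartite_ge i0P k0.
have -> : 1 / chi_cr R B = (#|V|%:R - (sigma B)%:R) / (k.-1%:R * #|V|%:R).
  rewrite /chi_cr chi_complete_multipartite div1r invfM invf_div -{1}(prednK k0) -natr1 addrK.
  by rewrite invfM mulrCA.
by apply: ler_wpM2r; rewrite ?invr_ge0 ?mulr_ge0 // lerB // ler_nat.
Qed.

End CriticalChromaticNumber.

(** * The random block partition *)

(* In a random partition into blocks the non-neighbourhood of a vertex is
   rarely over-represented in a block, by the second moment bound. *)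
Lemma exists_block_partition (R : realFieldType) (n : nat) (G : ograph n)
    (N s K theta : nat) (mu : R) :
  (0 < s)%N -> (0 < K)%N -> (N * s <= n <= 2 * (N * s))%N ->
  (forall v, #|[set u | ~~ adj G v u]|%:R <= mu * n%:R) ->
  (mu + K%:R^-1) * s%:R <= theta.+1%:R ->
  exists x : 'I_N -> 'I_s -> 'I_n,
    (forall j j' a a', x j a = x j' a' -> j = j' /\ a = a') /\
    (s * #|[set u : 'I_N * 'I_N | bad_pair G K theta x u.1 u.2]| <=
      2 * K ^ 4 * N ^ 2 + s * N)%N.
Proof.
move=> s0 K0 /andP[Nsn nNs] muP thetaP.
have io_lt (j : 'I_N) (a : 'I_s) : (j * s + a < n)%N.
  apply: leq_trans Nsn; apply: (@leq_trans (j.+1 * s)).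
    by rewrite mulSn addnC ltn_add2r.
  by rewrite leq_mul2r ltn_ord orbT.
pose io j a := Ordinal (io_lt j a).
have io_inj j j' a a' : io j a = io j' a' -> j = j' /\ a = a'.
  move=> [e]; split; apply/val_inj => /=.
    by have := congr1 (fun i => i %/ s)%N e; rewrite !divnMDl // !divn_small ?addn0.
  by have := congr1 (fun i => i %% s)%N e; rewrite !modnMDl !modn_small.
pose nn v : R := #|[set u | ~~ adj G v u]|%:R.
pose F (v u : 'I_n) : R := (~~ adj G v u)%:R - nn v / n%:R.
have nat_sum (T : finType) (P : pred T) : \sum_(u : T) (P u)%:R = #|[set u | P u]|%:R :> R.
  rewrite -sum1_card natr_sum [RHS]big_mkcond; apply: eq_bigr => u _.
  by rewrite inE; case: (P u).
have n0 (v : 'I_n) : (0 < n%:R :> R).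
  by rewrite ltr0n; apply: leq_ltn_trans (ltn_ord v).
have F0 v : \sum_u F v u = 0.
  rewrite sumrB nat_sum sumr_const card_ord -[_ *+ n]mulr_natr divfK ?subrr //.
  exact: (lt0r_neq0 (n0 v)).
have nnP v : 0 <= nn v / n%:R <= 1.
  apply/andP; split; first by rewrite divr_ge0 /nn ?ler0n.
  rewrite ler_pdivrMr ?(n0 v) // mul1r ler_nat.
  by apply: leq_trans (max_card _) _; rewrite card_ord.
have F1 v u : `|F v u| <= 1.
  have := nnP v; rewrite /F ler_norml; move: (nn v / n%:R) => q /andP[h1 h2].
  by move: h1 h2; clear; case: (~~ adj G v u) => /= h1 h2; lra.
have [t tP] := exists_balanced_perm (fun j a a' e => (io_inj j j a a' e).2) F0 F1.
pose x j a := t (io j a).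
have x_inj j j' a a' : x j a = x j' a' -> j = j' /\ a = a'.
  by move=> /perm_inj/io_inj.
exists x; split=> //.
pose O := #|[set w : 'I_n * 'I_N | overfull G theta x w.1 w.2]|.
(* Chebyshev: by [thetaP] an overfull block exceeds its expected number of non-neighbours by at
   least [s / K], hence contributes at least [(s / K) ^ 2] to the second moment. *)
have O1 : (O * s <= K ^ 2 * (n * N))%N.
  have sK : O%:R * (s%:R / K%:R) ^+ 2 <= n%:R * (N%:R * s%:R) :> R.
    rewrite card_ord in tP; apply: le_trans tP; rewrite pair_bigA /=.
    rewrite /O -nat_sum mulr_suml; apply: ler_sum => -[v j] _ /=.
    case: (boolP (overfull _ _ _ _ _)) => [vj|_]; last by rewrite mul0r sqr_ge0.
    rewrite mul1r; have sumF : s%:R / K%:R <= \sum_a F v (t (io j a)).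
      rewrite sumrB (nat_sum _ (fun a => ~~ adj G v (x j a))) sumr_const card_ord.
      rewrite -[_ *+ s]mulr_natl.
      have nmu : nn v / n%:R <= mu by rewrite ler_pdivrMr ?(n0 v) //; apply: muP.
      have := ler_wpM2l (ler0n R s) nmu.
      move: vj; rewrite /overfull -(ler_nat R) => vj h1.
      move: thetaP vj h1; rewrite mulrDl [K%:R^-1 * _]mulrC [mu * _]mulrC.
      clear; move: (nn v / _) => q h1 h2 h3; lra.
    by rewrite lerXn2r // nnegrE ?divr_ge0 //; apply: le_trans sumF; rewrite divr_ge0.
  rewrite -(leq_pmul2r s0) -(ler_nat R) !natrM.
  have K0' : (0 < K%:R :> R) by rewrite ltr0n.
  have E : O%:R * (s%:R / K%:R) ^+ 2 = O%:R * s%:R ^+ 2 / K%:R ^+ 2 :> R.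
    by rewrite expr_div_n mulrA.
  rewrite E ler_pdivrMr ?exprn_gt0 // in sK.
  by move: sK; clear; lra.
pose bad' := [set u : 'I_N * 'I_N | (s < #|[set a | overfull G theta x (x u.1 a) u.2]| * K ^ 2)%N].
have b1 : (#|[set u : 'I_N * 'I_N | bad_pair G K theta x u.1 u.2]| <= N + #|bad'|)%N.
  apply: leq_trans (leq_add (_ : #|[set u : 'I_N * 'I_N | u.1 == u.2]| <= N)%N (leqnn _)); last first.
    have dinj : injective (fun j : 'I_N => (j, j)) by move=> j j' [].
    rewrite -[leqRHS]card_ord -[leqRHS](card_imset _ dinj).
    apply/subset_leq_card/subsetP => -[j j']; rewrite inE /= => /eqP <-.
    exact: imset_f.
  apply: leq_trans (leq_card_setU _ _); apply/subset_leq_card/subsetP => u.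
  by rewrite !inE.
(* Markov: a pair in [bad'] has more than [s / K ^ 2] overfull incidences, and by injectivity of [x]
   each incidence in [O] is counted at most once. *)
have b2 : (s * #|bad'| <= K ^ 2 * O)%N.
  rewrite mulnC -sum_nat_const.
  apply: (@leq_trans (\sum_(u : 'I_N * 'I_N) K ^ 2 * #|[set a | overfull G theta x (x u.1 a) u.2]|)).
    rewrite [leqRHS](bigID (mem bad')) /=; apply: leq_trans (leq_addr _ _).
    by apply: leq_sum => u; rewrite inE mulnC => /ltnW.
  rewrite -big_distrr /= leq_mul2l; apply/orP; right.
  rewrite (eq_bigr (fun u : 'I_N * 'I_N => \sum_(a | overfull G theta x (x u.1 a) u.2) 1)%N); last first.
    by move=> u _; rewrite sum1dep_card.
  rewrite pair_big_dep sum1dep_card.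
  have inj3 : injective (fun w : ('I_N * 'I_N) * 'I_s => (x w.1.1 w.2, w.1.2)).
    by move=> [[j j'] a] [[i i'] a'] /= [/x_inj[-> ->] ->].
  rewrite -(card_imset _ inj3); apply/subset_leq_card/subsetP => _ /imsetP[w + ->].
  by rewrite !inE.
have h1 := leq_mul (leqnn s) b1; have h2 := leq_mul (leqnn s) b2.
have h3 := leq_mul (leqnn (K ^ 2)) O1.
have h4 : (K ^ 4 * N * n <= K ^ 4 * N * (2 * (N * s)))%N by rewrite leq_mul2l nNs orbT.
have h5 : (s * #|bad'| <= 2 * K ^ 4 * N ^ 2)%N.
  rewrite -(leq_pmul2l s0).
  have E1 : (K ^ 2 * (K ^ 2 * (n * N)) = K ^ 4 * N * n)%N by ring.
  have E2 : (s * (2 * K ^ 4 * N ^ 2) = K ^ 4 * N * (2 * (N * s)))%N by ring.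
  rewrite E2; apply: leq_trans h4; rewrite -E1; apply: leq_trans h3.
  by apply: leq_trans h2 _; rewrite mulnCA [(s * O)%N]mulnC.
by apply: leq_trans h1 _; rewrite mulnDr addnC leq_add2r.
Qed.

(** * Choice of constants and conclusion *)

Lemma non_neighbours_le (R : realType) (n : nat) (G : ograph n) (c : R) (v : 'I_n) :
  c * n%:R <= (min_degree G)%:R ->
  #|[set u | ~~ adj G v u]|%:R <= (1 - c) * n%:R.
Proof.
move=> cG; have dv : (min_degree G <= #|[set u | adj G v u]|)%N.
  exact: (@bigminn_le _ _ _ (fun v => #|[set u | adj G v u]|)) (mem_index_enum v).
have := cardsC [set u | adj G v u]; rewrite card_ord.
have -> : ~: [set u | adj G v u] = [set u | ~~ adj G v u] by apply/setP => u; rewrite !inE.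
move/(congr1 (fun m => m%:R : R)); rewrite natrD => E.
by move: dv cG E; rewrite -(ler_nat R) => dv cG E; clear -dv cG E; lra.
Qed.

(** The loss [3 / K] pays for [2 * s] and for passing from [K] to [K - 1]: [2 + K * (alpha - 3 / K)
    = K * alpha - 1 <= (K - 1) * alpha] if [alpha <= 1], which [h2] provides in multiplied form. *)
Lemma threshold_arith (R : realType) (r bV sg K s : nat) (alpha theta : R) :
  (sg <= bV)%N -> (0 < K)%N -> alpha * (r.+1%:R * bV%:R) = bV%:R - sg%:R ->
  theta <= (alpha - 3 / K%:R) * s%:R ->
  r.+1%:R * (2 * s%:R + K%:R * theta) * bV%:R <= (bV%:R - sg%:R) * ((K%:R - 1) * s%:R).
Proof.
move=> sgb K0 alphaE thetaP.
have K0' : (0 < K%:R :> R) by rewrite ltr0n.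
have rb : 0 <= r.+1%:R * bV%:R :> R by rewrite mulr_ge0.
have h1 : K%:R * theta <= (alpha * K%:R - 3) * s%:R.
  have := ler_wpM2l (ltW K0') thetaP.
  by rewrite mulrA mulrBr [K%:R * (3 / _)]mulrC divfK ?lt0r_neq0 // [K%:R * alpha]mulrC.
have h2 : bV%:R - sg%:R <= r.+1%:R * bV%:R :> R.
  have b0 : 0 <= bV%:R :> R by [].
  have s0 : 0 <= sg%:R :> R by [].
  have r0 : 0 <= r%:R :> R by [].
  by rewrite -natr1 mulrDl mul1r; have := mulr_ge0 r0 b0; lra.
have h3 := ler_wpM2r (ler0n R s) h2.
have h4 := ler_wpM2l rb (lerD (lexx (2 * s%:R)) h1).
have -> : r.+1%:R * (2 * s%:R + K%:R * theta) * bV%:R =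
    (r.+1%:R * bV%:R) * (2 * s%:R + K%:R * theta) by ring.
apply: le_trans h4 _; move: h3; rewrite -alphaE.
by move: (r.+1%:R * bV%:R) => c; clear; lra.
Qed.

(** Of the four [n], two come from the ratio [K.-1 / K.+1], one from the fewer than [s] vertices
    outside the blocks, and one from the [z] blocks given up. *)
Lemma leftover_arith (n s N K z D : nat) :
  (K.-1 * s * N <= D * K.+1 + K.-1 * s * z)%N -> (z * K <= N)%N ->
  (N * s <= n < N.+1 * s)%N -> (K * s <= n)%N -> (0 < K)%N ->
  (K.+1 * (n - D) <= 4 * n)%N.
Proof.
move=> cov zK /andP[nN Nn] Ks K0.
rewrite mulnBr leq_subLR.
have h1 : (K * s * z <= s * N)%N by rewrite mulnC mulnA mulnC leq_mul2l zK orbT.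
case: K K0 cov zK Ks h1 => // K _ /=.
rewrite !mulSn => cov zK Ks h1.
have h2 : (K * n <= K * (s + N * s))%N by rewrite leq_mul2l (ltnW Nn) orbT.
lia.
Qed.

(** After division by [s] each term on the right is at most [N ^ 2 / (16 * K ^ 4)], so
    [8 * K ^ 4 * Nb <= N ^ 2]; the rest is [N <= 2 * z * K]. *)
Lemma few_bad_arith (s K N z Nb : nat) :
  (0 < K)%N -> s = (32 * K ^ 8)%N -> (16 * K ^ 4 + K <= N)%N -> z = (N %/ K)%N ->
  (s * Nb <= 2 * K ^ 4 * N ^ 2 + s * N)%N -> (2 * K ^ 2 * Nb <= z ^ 2)%N.
Proof.
move=> K0 sE NK zE sNb.
have K4 : (0 < K ^ 4)%N by rewrite expn_gt0 K0.
have s0 : (0 < s)%N by rewrite sE muln_gt0 expn_gt0 K0.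
have h1 : (8 * K ^ 4 * Nb <= N ^ 2)%N.
  rewrite -(leq_pmul2l s0).
  have h2 := leq_mul (leqnn (8 * K ^ 4)) sNb.
  have E : (2 * (8 * K ^ 4 * (2 * K ^ 4 * N ^ 2)) = s * N ^ 2)%N.
    by rewrite sE (_ : K ^ 8 = K ^ 4 * K ^ 4)%N -?expnD //; ring.
  have h3 : (s * (16 * K ^ 4 * N) <= s * N ^ 2)%N.
    by rewrite leq_mul2l -mulnn leq_mul2r (leq_trans (leq_addr _ _) NK) !orbT.
  by move: (K ^ 4)%N (N ^ 2)%N h2 E h3 => A C; clear; lia.
have z0 : (0 < z)%N by rewrite zE divn_gt0 // (leq_trans (leq_addl _ _) NK).
have h2 : (N ^ 2 <= (2 * z * K) ^ 2)%N.
  rewrite leq_sqr; apply: leq_trans (ltnW (ltn_ceil N K0)) _.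
  by rewrite -zE leq_mul2r; lia.
have K2 : (0 < 4 * K ^ 2)%N by rewrite muln_gt0 expn_gt0 K0.
rewrite -(leq_pmul2l K2); apply: leq_trans (leq_trans _ h2) _.
  by apply: leq_trans h1; rewrite (_ : K ^ 4 = K ^ 2 * K ^ 2)%N -?expnD //; lia.
by rewrite -!mulnn; lia.
Qed.

Theorem theorem4p3 (R : realType) (h : nat) (H : ograph h)
    (V : finType) (B : sgraph V) (k : nat) (part : V -> 'I_k)
    (hk : (2 <= k)%N) (hB : complete_multipartite B part)
    (hHB : bottlegraph H B part) (eta : R) (heta : 0 < eta) :
  exists n0 : nat, forall n : nat, (n0 <= n)%N -> forall G : ograph n,
    (1 - 1 / chi_cr R B + eta) * n%:R <= (min_degree G)%:R ->
    exists T : {set {ffun 'I_h -> 'I_n}},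
      tiling H G T /\ (#|~: covered T|%:R <= eta * n%:R).
Proof.
case: k part hk hB hHB => [//|[//|r]] part _ hB hHB.
pose b i := #|[set x | part x == i]|.
have [i0 i0P] : exists i0, forall i, (b i0 <= b i)%N.
  by case: (@arg_minnP _ ord0 predT b isT) => i _ iP; exists i => j; apply: iP.
set bV := #|V|; pose sg := b i0.
have sgV : (sg < bV)%N.
  rewrite /bV -(sum_part_size part) (bigD1_ord i0) //= -addn1 leq_add2l.
  by rewrite big_ord_recl; apply: leq_trans (part_size_gt0 hB _) (leq_addr _ _).
(* The density of non-neighbours that [weighted_clique] tolerates when [i0] is a smallest part. *)
pose alpha : R := (bV%:R - sg%:R) / (r.+1%:R * bV%:R).
have rb0 : 0 < r.+1%:R * bV%:R :> R.
  by rewrite mulr_gt0 ?ltr0n //; apply: leq_ltn_trans sgV.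
have alphaE : alpha * (r.+1%:R * bV%:R) = bV%:R - sg%:R.
  by rewrite /alpha divfK ?lt0r_neq0.
have alpha0 : 0 < alpha by rewrite divr_gt0 // subr_gt0 ltr_nat.
have chi_le : 1 / chi_cr R B <= alpha := inv_chi_cr_le hB R i0P.
have [L [L0 hL]] := bottlegraph_tileable hB hHB.
(* [4 / K <= eta] bounds the uncovered proportion and leaves room for [1 / K + 3 / K] around
   [theta]; [3 / K <= alpha] makes the number truncated in [theta] nonnegative. *)
pose K := (Num.bound (4 / eta) + Num.bound (3 / alpha)).+2.
have K_gt (y c : R) : 0 < y -> 0 < c -> (Num.bound (c / y) <= K)%N -> c / K%:R <= y.
  move=> y0 c0 yK; rewrite ler_pdivrMr ?ltr0n // mulrC -ler_pdivrMr //.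
  apply: ltW; apply: lt_le_trans (archi_boundP (ltW (divr_gt0 c0 y0))) _.
  by rewrite ler_nat.
have K_eta : 4 / K%:R <= eta by apply: K_gt => //; do 2!apply: leqW; apply: leq_addr.
have K_alpha : 3 / K%:R <= alpha by apply: K_gt => //; do 2!apply: leqW; apply: leq_addl.
have K1 : (1 < K)%N by [].
clearbody K; have K0 : (0 < K)%N := ltnW K1.
have [s sE] : exists s, s = (32 * K ^ 8)%N by exists (32 * K ^ 8)%N.
have s0 : (0 < s)%N by rewrite sE muln_gt0 expn_gt0 K0.
(* The threshold is low enough for the reduced degree condition [cond], yet by [thP] exceeds the
   expected number of non-neighbours enough for the second moment bound. *)
pose theta := Num.truncn ((alpha - 3 / K%:R) * s%:R).
have th0 : 0 <= (alpha - 3 / K%:R) * s%:R by rewrite mulr_ge0 // subr_ge0.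
have /andP[th1 th2] := truncn_itv th0; rewrite -/theta in th1 th2.
have cond : (r.+1 * (2 * s + K * theta) * bV <= (bV - sg) * (K.-1 * s))%N.
  have := threshold_arith (ltnW sgV) K0 alphaE th1.
  rewrite -(ler_nat R) !natrM natrD !natrM natrB ?(ltnW sgV) //.
  by rewrite -subn1 natrB.
pose m := (L * (bV * (K * s) * K * K.+1))%N.
have m0 : (0 < m)%N.
  by rewrite !muln_gt0 L0 K0 s0 !andbT /=; apply: leq_ltn_trans sgV.
have [N0 hN0] := homogeneous_box K #|{ffun 'I_s * 'I_s -> bool * bool}| m0.
(* This gives [N0 <= z] by the first term and the bound on [N] in [few_bad_arith] by the other two;
   the last one also gives [K * s <= n]. *)
exists (s * (K * N0 + 16 * K ^ 4 + K))%N => n n0n G Gdeg.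
pose N := (n %/ s)%N; pose z := (N %/ K)%N.
have Nge : (K * N0 + 16 * K ^ 4 + K <= N)%N by rewrite leq_divRL // mulnC.
have zN0 : (N0 <= z)%N by rewrite leq_divRL // mulnC; lia.
have Nn : (N * s <= n < N.+1 * s)%N by rewrite leq_divM ltn_ceil.
have n2N : (N * s <= n <= 2 * (N * s))%N.
  case/andP: Nn => -> /ltnW nN /=; apply: leq_trans nN _.
  by rewrite mulnA leq_mul2r; lia.
have muP v : #|[set u | ~~ adj G v u]|%:R <= (alpha - eta) * n%:R.
  apply: le_trans (non_neighbours_le v Gdeg) _; apply: ler_wpM2r => //.
  by move: chi_le; clear; lra.
have thP : (alpha - eta + K%:R^-1) * s%:R <= theta.+1%:R.
  apply: le_trans (ltW th2); apply: ler_wpM2r => //.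
  by move: K_eta; clear; lra.
have [x [x_inj xbad]] := exists_block_partition s0 K0 n2N muP thP.
have badz : (2 * K ^ 2 * #|[set u : 'I_N * 'I_N | bad_pair G K theta x u.1 u.2]| <= z ^ 2)%N.
  by apply: few_bad_arith K0 sE _ erefl xbad; rewrite (leq_trans _ Nge) // -addnA leq_addl.
have [|D [[T Ttil TD] Dc]] :=
    greedy_blocks_tiling hB (hL n G) x_inj K1 s0 m0 erefl cond _ zN0 badz.
  by move=> T bad col NT; apply: hN0 => //; exact: [ffun=> (true, true)].
exists T; split=> //; rewrite TD cardsCs setCK.
have DnK : (K.+1 * (n - #|D|) <= 4 * n)%N.
  apply: leftover_arith Dc _ Nn _ K0; first by rewrite leq_divM.
  by apply: leq_trans n0n; rewrite mulnC leq_mul2l leq_addl orbT.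
rewrite card_ord; move: DnK; rewrite -(ler_nat R) !natrM => DnK.
have K0' : (0 < K%:R :> R) by rewrite ltr0n.
apply: le_trans (ler_wpM2r (ler0n R n) K_eta).
rewrite mulrAC ler_pdivlMr //; apply: le_trans DnK.
by rewrite mulrC ler_wpM2r // ler_nat.
Qed.
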